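(* Let $n\ge 1$, let $\mathcal P\subset\mathbb N$ be a finite nonempty index set, let $A_i\in\mathbb R^{n\times n}$ for $i\in\mathcal P$, let $K\in\{1,2,\dots\}$, and let $\underline a,\overline a>0$ and $\mu\ge 1$ be constants. Let $\mathcal T_K^{\mathbf F}$ be the triangulation described in the context. Suppose that the linear program $\mathrm{LP}(\underline a,\overline a,\mu,K)$ described in the context has a feasible solution, consisting of $\alpha$ and of values $V_{\mathbf x,i}$ for the vertices $\mathbf x$ of simplices of $\mathcal T_K^{\mathbf F}$ and $i\in\mathcal P$, with $\alpha>0$. For each $i\in\mathcal P$ define $V_i:\mathbb R^n\to\mathbb R$ as follows. For $\mathbf x\in\mathbb R^n$ choose a simplex $\mathfrak S_\nu=\mathrm{co}\{\mathbf 0,\mathbf x_1^\nu,\dots,\mathbf x_n^\nu\}\in\mathcal T_K^{\mathbf F}$ and numbers $\lambda_1,\dots,\lambda_n\ge 0$ with $\mathbf x=\sum_{j=1}^n\lambda_j\mathbf x_j^\nu$, and set $V_i(\mathbf x)=\sum_{j=1}^n\lambda_jV_{\mathbf x_j^\nu,i}$. Then each $V_i$ is a well-defined continuous function on $\mathbb R^n$ that is linear on each simplex of $\mathcal T_K^{\mathbf F}$. Moreover, with $\overline a':=\max_{\|\mathbf x\|=1}\max_{i\in\mathcal P}V_i(\mathbf x)$, for all $\mathbf x\in\mathbb R^n$ and all $i,k\in\mathcal P$, $$\underline a\|\mathbf x\|\le V_i(\mathbf x)\le\overline a'\|\mathbf x\|,\qquad D^+V_i(\mathbf x,A_i\mathbf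 x)\le-\frac{\alpha}{\overline a}V_i(\mathbf x),\qquad V_i(\mathbf x)\le\mu V_k(\mathbf x).$$ Consequently, for every $\tau_a>0$ satisfying $$\tau_a>\frac{\overline a\,\ln(\mu)}{\alpha},$$ the origin is globally exponentially stable for the switched linear system $\dot{\mathbf x}=A_\sigma\mathbf x$, uniformly over the switching signals $\sigma$ with average dwell-time $\tau_a$.
   Context: Norms: $\|\cdot\|$ is the Euclidean norm and $\|\cdot\|_\infty$ the maximum norm on $\mathbb R^n$; $\mathrm{co}$ denotes the convex hull; $\mathbf e_i$ is the $i$-th standard unit vector. Switched system: A switching signal is a piecewise constant, right-continuous function $\sigma:[0,\infty)\to\mathcal P$ whose discontinuities (switching times) are locally finite. The switched linear system is $\dot{\mathbf x}(t)=A_{\sigma(t)}\mathbf x(t)$. $N_\sigma(t,s)$ is the number of switching times of $\sigma$ in $(s,t)$. The signal $\sigma$ has average dwell-time $\tau_a>0$ if there exists $N_0>0$ such that $N_\sigma(t,s)\le N_0+\frac{t-s}{\tau_a}$ for all $t\ge s\ge 0$. Global exponential stability of the origin, uniformly over the switching signals with average dwell-time $\tau_a$, means: for every $N_0>0$ there are constants $c,\lambda>0$ such that for every switching signal $\sigma$ satisfying $N_\sigma(t,s)\le N_0+\frac{t-s}{\tau_a}$ for all $t\ge s\ge0$, every solution satisfies $\|\mathbf x(t)\|\le c\,e^{-\lambda t}\|\mathbf x(0)\|$ for all $t\ge 0$. Dini derivative: for continuous $V:\mathbb R^n\to\mathbb R$, $D^+V(\mathbf x,A_i\mathbf x):=\limsup_{h\to0+}\frac{V(\boldsymbol\phi_i(h,\mathbf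 x))-V(\mathbf x)}{h}$, where $t\mapsto\boldsymbol\phi_i(t,\mathbf x)$ is the solution of $\dot{\mathbf x}=A_i\mathbf x$ with $\boldsymbol\phi_i(0,\mathbf x)=\mathbf x$. Triangulation: For $\mathcal J\subset\{1,\dots,n\}$ let $\mathbf R^{\mathcal J}:\mathbb R^n\to\mathbb R^n$ be the map that changes the sign of the coordinates $x_i$ with $i\in\mathcal J$ and leaves the others unchanged. For $\mathbf z\in\{0,1,2,\dots\}^n$, $\mathcal J\subset\{1,\dots,n\}$, a permutation $\rho$ of $\{1,\dots,n\}$, and $j=0,\dots,n$, put $\mathbf x_j^{\mathbf z\mathcal J\rho}=\mathbf R^{\mathcal J}\big(\mathbf z+\sum_{i=1}^j\mathbf e_{\rho(i)}\big)$. The standard triangulation consists of the simplices $\mathrm{co}\{\mathbf x_0^{\mathbf z\mathcal J\rho},\dots,\mathbf x_n^{\mathbf z\mathcal J\rho}\}$. Consider those simplices of the standard triangulation contained in $[-K,K]^n$ for which exactly one vertex has $\|\cdot\|_\infty<K$ (this vertex is necessarily $\mathbf x_0^{\mathbf z\mathcal J\rho}$) and the other $n$ vertices have $\|\cdot\|_\infty=K$. Replacing the vertex $\mathbf x_0^{\mathbf z\mathcal J\rho}$ by $\mathbf 0$ in each of them gives the triangulation $\mathcal T_K$ of $[-K,K]^n$, with simplices $\mathrm{co}\{\mathbf 0,\mathbf x_1^{\mathbf z\mathcal J\rho},\dots,\mathbf x_n^{\mathbf z\mathcal J\rho}\}$. Let $\mathbf F:\mathbb R^n\to\mathbb R^n$,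 $\mathbf F(\mathbf 0)=\mathbf 0$, $\mathbf F(\mathbf x)=\frac{\|\mathbf x\|}{\|\mathbf x\|_\infty}\mathbf x$ for $\mathbf x\ne\mathbf 0$. The triangulation $\mathcal T_K^{\mathbf F}$ consists of the simplices $\mathrm{co}\{\mathbf 0,\mathbf F(\mathbf y_1),\dots,\mathbf F(\mathbf y_n)\}$ with $\mathrm{co}\{\mathbf 0,\mathbf y_1,\dots,\mathbf y_n\}\in\mathcal T_K$. A simplex of $\mathcal T_K^{\mathbf F}$ is written $\mathfrak S_\nu=\mathrm{co}\{\mathbf 0,\mathbf x_1^\nu,\dots,\mathbf x_n^\nu\}$, where $\mathbf x_1^\nu,\dots,\mathbf x_n^\nu$ are its nonzero vertices, and $X_\nu=(\mathbf x_1^\nu\ \cdots\ \mathbf x_n^\nu)\in\mathbb R^{n\times n}$ is the matrix with these columns. Linear program $\mathrm{LP}(\underline a,\overline a,\mu,K)$: the variables are $\alpha\in\mathbb R$ and $V_{\mathbf x,i}\in\mathbb R$ for every vertex $\mathbf x$ of a simplex in $\mathcal T_K^{\mathbf F}$ and every $i\in\mathcal P$. The objective is to maximize $\alpha$. The constraints are: (1) $V_{\mathbf 0,i}=0$ and $\underline a\|\mathbf x\|\le V_{\mathbf x,i}\le\overline a\|\mathbf x\|$ for every vertex $\mathbf x$ of a simplex in $\mathcal T_K^{\mathbf F}$ and every $i\in\mathcal P$; (2) for every $\mathfrak S_\nu\in\mathcal T_K^{\mathbf F}$, every $j=1,\dots,n$ and every $i\in\mathcal P$, $\mathbf v_{\nu,i}^\top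 X_\nu^{-1}A_i\mathbf x_j^\nu\le-\alpha\|\mathbf x_j^\nu\|$, where $\mathbf v_{\nu,i}=(V_{\mathbf x_1^\nu,i}\ \cdots\ V_{\mathbf x_n^\nu,i})^\top$; (3) $V_{\mathbf x,j}\le\mu V_{\mathbf x,i}$ for every vertex $\mathbf x$ of a simplex in $\mathcal T_K^{\mathbf F}$ and all $i,j\in\mathcal P$. *)

(* Defs.v *)
From mathcomp Require Import all_boot all_order all_fingroup all_algebra.
From mathcomp Require Import finmap.
From mathcomp Require Import all_classical all_reals all_analysis.

Set Implicit Arguments.
Unset Strict Implicit.
Unset Printing Implicit Defensive.

Import Order.TTheory GRing.Theory Num.Theory.
Import numFieldNormedType.Exports.

Local Open Scope classical_set_scope.
Local Open Scope ring_scope.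

(* Vectors are columns.  On ['cV[R]_n] the library norm [`|x|] is the maximum
   norm; the Euclidean norm is [enorm]. *)
Definition enorm (R : realType) (n : nat) (x : 'cV[R]_n) : R :=
  Num.sqrt (\sum_(k < n) x k 0 ^+ 2).

Definition conv_hull (R : realType) (n m : nat) (v : 'I_m -> 'cV[R]_n) :
    set 'cV[R]_n :=
  [set x | exists l : 'I_m -> R,
     [/\ forall j, 0 <= l j, \sum_j l j = 1 & x = \sum_j l j *: v j]].

Definition is_max (R : realType) (S : set R) (a : R) : Prop :=
  S a /\ ubound S a.

(** * Triangulations *)

(* The data (z, J, rho) of a simplex of the standard triangulation. *)
Record simplex_index (n : nat) := SimplexIndex {
  si_z : 'cV[nat]_n ;
  si_J : {set 'I_n} ;
  si_rho : 'S_n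
}.

Definition reflection (R : realType) (n : nat) (J : {set 'I_n})
    (x : 'cV[R]_n) : 'cV[R]_n :=
  \col_k (if k \in J then - x k 0 else x k 0).

(* Since ['I_n] starts at 0, the sum over i = 1..j is the sum over i < j. *)
Definition std_vertex (R : realType) (n : nat) (nu : simplex_index n)
    (j : nat) : 'cV[R]_n :=
  reflection (si_J nu)
    (map_mx (fun m : nat => m%:R) (si_z nu)
     + \sum_(i < n | (i < j)%N) delta_mx (si_rho nu i) 0).

Definition std_simplex (R : realType) (n : nat) (nu : simplex_index n) :
    set 'cV[R]_n :=
  conv_hull (fun j : 'I_n.+1 => std_vertex R nu j).

Definition cube (R : realType) (n : nat) (K : nat) : set 'cV[R]_n :=
  [set x | forall k, - K%:R <= x k 0 <= K%:R].

(* The indices of the simplices of T_K, equivalently of T_K^F. *)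
Definition TK (R : realType) (n : nat) (K : nat) : set (simplex_index n) :=
  [set nu |
    [/\ std_simplex nu `<=` @cube R n K,
        exists! j : 'I_n.+1, `|std_vertex R nu j| < K%:R
      & forall j : 'I_n.+1, ~ (`|std_vertex R nu j| < K%:R) ->
          `|std_vertex R nu j| = K%:R]].

Definition Fmap (R : realType) (n : nat) (x : 'cV[R]_n) : 'cV[R]_n :=
  if x == 0 then 0 else (enorm x / `|x|) *: x.

(* [fan_vertex nu j] is the (j+1)-st nonzero vertex of the simplex nu of
   T_K^F. *)
Definition fan_vertex (R : realType) (n : nat) (nu : simplex_index n)
    (j : 'I_n) : 'cV[R]_n :=
  Fmap (std_vertex R nu j.+1).

Definition fan_simplex (R : realType) (n : nat) (nu : simplex_index n) :
    set 'cV[R]_n :=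
  conv_hull (fun j : 'I_n.+1 => oapp (fan_vertex R nu) 0 (unlift ord0 j)).

Definition Xmat (R : realType) (n : nat) (nu : simplex_index n) : 'M[R]_n :=
  \matrix_(k, j) fan_vertex R nu j k 0.

Definition is_vertex (R : realType) (n : nat) (K : nat) (x : 'cV[R]_n) : Prop :=
  exists2 nu : simplex_index n, TK R K nu &
    x = 0 \/ exists j, x = fan_vertex R nu j.

(** * The linear program *)

(* The LP variables V_{x,i} are given by a function on all of R^n; only its
   values at vertices of T_K^F are constrained or used. *)
Record LP_feasible (R : realType) (n : nat) (P : {fset nat})
    (A : P -> 'M[R]_n) (amin amax mu : R) (K : nat)
    (alpha : R) (Vx : 'cV[R]_n -> P -> R) : Prop := LPFeasible {
  LP_zero : forall i, Vx 0 i = 0 ;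
  LP_bounds : forall x i, is_vertex K x ->
    amin * enorm x <= Vx x i <= amax * enorm x ;
  LP_decrease : forall nu, TK R K nu -> forall (j : 'I_n) (i : P),
    ((\row_l Vx (fan_vertex R nu l) i) *m invmx (Xmat R nu) *m A i
       *m fan_vertex R nu j) 0 0
    <= - alpha * enorm (fan_vertex R nu j) ;
  LP_mu : forall x i j, is_vertex K x -> Vx x j <= mu * Vx x i
}.

(* [interpolant K Vx i x y]: some choice of a simplex and of coefficients
   for x yields the value y for V_i(x). *)
Definition interpolant (R : realType) (n : nat) (P : {fset nat}) (K : nat)
    (Vx : 'cV[R]_n -> P -> R) (i : P) (x : 'cV[R]_n) (y : R) : Prop :=
  exists2 nu : simplex_index n, TK R K nu &
    exists l : 'I_n -> R,
      [/\ forall j, 0 <= l j,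
          x = \sum_j l j *: fan_vertex R nu j
        & y = \sum_j l j * Vx (fan_vertex R nu j) i].

(** * Dini derivative *)

Definition is_flow (R : realType) (n : nat) (A : 'M[R]_n) (x : 'cV[R]_n)
    (phi : R -> 'cV[R]_n) : Prop :=
  phi 0 = x /\ forall t : R, is_derive t (1 : R) phi (A *m phi t).

(* The solution of x' = A x starting at x; it exists and is unique, so that
   the default value of [xget] is irrelevant. *)
Definition flow (R : realType) (n : nat) (A : 'M[R]_n) (x : 'cV[R]_n) :
    R -> 'cV[R]_n :=
  xget (fun=> 0) [set phi | is_flow A x phi].

Definition dini (R : realType) (n : nat) (V : 'cV[R]_n -> R) (A : 'M[R]_n)
    (x : 'cV[R]_n) : \bar R :=
  limf_esup (fun h : R => ((V (flow A x h) - V x) / h)%:E) (0 : R)^'+.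

(** * Switched systems *)

(* Signals and trajectories are functions on R of which only the restriction
   to [0, +oo[ matters.  The index set is discrete, so continuity of a signal
   means local constancy. *)
Definition switching_time (R : realType) (P : {fset nat}) (sigma : R -> P) :
    set R :=
  [set t : R | 0 < t /\ ~ (\forall s \near t, sigma s = sigma t)].

Definition switching_signal (R : realType) (P : {fset nat}) (sigma : R -> P) :
    Prop :=
  (forall t : R, 0 <= t -> \forall s \near t^'+, sigma s = sigma t) /\
  (forall T : R, finite_set [set t : R | switching_time sigma t /\ t <= T]).

Definition num_switches (R : realType) (P : {fset nat}) (sigma : R -> P)
    (t s : R) : nat :=
  #|` fset_set [set r : R | switching_time sigma r /\ s < r < t]|%fset.

Definition dwell_bound (R : realType) (P : {fset nat}) (N0 tau : R)
    (sigma : R -> P) : Prop :=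
  forall t s : R, 0 <= s -> s <= t ->
    (num_switches sigma t s)%:R <= N0 + (t - s) / tau.

Definition switched_solution (R : realType) (n : nat) (P : {fset nat})
    (A : P -> 'M[R]_n) (sigma : R -> P) (x : R -> 'cV[R]_n) : Prop :=
  {within [set t : R | 0 <= t], continuous x} /\
  (forall t : R, 0 < t -> ~ switching_time sigma t ->
     is_derive t (1 : R) x (A (sigma t) *m x t)).

Definition uniformly_GES (R : realType) (n : nat) (P : {fset nat})
    (A : P -> 'M[R]_n) (tau : R) : Prop :=
  forall N0 : R, 0 < N0 ->
  exists c lambda : R, [/\ 0 < c, 0 < lambda &
    forall sigma : R -> P, switching_signal sigma -> dwell_bound N0 tau sigma ->
    forall x : R -> 'cV[R]_n, switched_solution A sigma x ->
    forall t : R, 0 <= t ->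
      enorm (x t) <= c * expR (- lambda * t) * enorm (x 0)].

(* Main.v *)
(** If x = sum_j m_j y_j is a conic combination of the vertices of a simplex of
    T_K, then th |-> y_j for th in (T_{j+1}, T_j), with T_j = sum_{i >= j} m_i,
    is a step function whose value at th depends only on x and th: its
    coordinates are, up to the signs of x, the ceilings of (|x_k| - th) / T_0.
    Hence sum_j m_j G(y_j), the integral of G along this step function, depends
    only on x, which makes V_i well defined.  The simplex containing x is found
    by sorting the fractional parts of the |x_k|, scaled to the boundary of the
    cube.

    The cones over the simplices are closed and finite in number, so each point
    near x shares a cone with x, on which V_i is linear.  This gives continuity
    and reduces the Dini derivative of V_i along a trajectory to the
    constraint (2), extended linearly from the vertices.  Between two switching
    times V_i thus decays at rate alpha / amax, each switch costs a factor mu,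
    and the dwell-time bound makes the decay win. *)

From HB Require Import structures.
Require Import Defs.
From mathcomp Require Import all_boot all_order all_fingroup all_algebra.
From mathcomp Require Import finmap.
From mathcomp Require Import all_classical all_reals all_analysis.
From mathcomp Require Import ring lra zify.
Import Order.TTheory GRing.Theory Num.Theory.
Import numFieldNormedType.Exports.
Local Open Scope classical_set_scope.
Local Open Scope ring_scope.

Set Implicit Arguments.
Unset Strict Implicit.
Unset Printing Implicit Defensive.

(** * Sums of step functions over overlapping subdivisions *)

(** The function [Num.max a (Num.min a' t)] of t clamps to [a, a'], so its increment over [b, b'] is
    the length of the overlap of the two intervals. As an increment it telescopes in
    [sum_overlap]. *)
Lemma overlap_clamp (R : realType) (a a' b b' : R) : a <= a' -> b <= b' ->
  Num.max a (Num.min a' b') - Num.max a (Num.min a' b) =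
  Num.max 0 (Num.min a' b' - Num.max a b).
Proof.
move=> aa bb.
have [h1|h1] := leP a' b'; have [h2|h2] := leP a' b; have [h3|h3] := leP a b;
 rewrite ?(max_r aa) ?(max_l aa).
all: repeat match goal with |- context [Num.max ?x ?y] => case: (leP x y) => ? end.
all: lra.
Qed.

Lemma sum_overlap (R : realType) (n : nat) (a a' : R) (b : nat -> R) :
  a <= a' -> (forall j, b j.+1 <= b j) -> a' <= b 0%N -> b n <= a ->
  \sum_(j < n) Num.max 0 (Num.min a' (b j) - Num.max a (b j.+1)) = a' - a.
Proof.
move=> aa bb b0 bn.
under eq_bigr do rewrite -overlap_clamp//.
rewrite -(big_mkord xpredT (fun j => Num.max a (Num.min a' (b j))
  - Num.max a (Num.min a' (b j.+1)))).
under eq_bigr do rewrite -opprB.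
rewrite sumrN telescope_sumr// opprB min_l// (max_r aa).
by rewrite min_r ?(le_trans bn)// max_l.
Qed.

(* Both sums equal the sum over all pairs (i, i') of the common value times
   the length of the overlap of the two intervals. *)
Lemma step_sum_unique (R : realType) (n n' : nat) (a a' : nat -> R)
    (c c' : nat -> R) :
  (forall j, a j.+1 <= a j) -> (forall j, a' j.+1 <= a' j) ->
  a 0%N = a' 0%N -> a n = a' n' ->
  (forall (i : 'I_n) (i' : 'I_n') th, a i.+1 < th < a i ->
     a' i'.+1 < th < a' i' -> c i = c' i') ->
  \sum_(i < n) (a i - a i.+1) * c i = \sum_(i < n') (a' i - a' i.+1) * c' i.
Proof.
move=> da da' a0 an cc.
have mono (f : nat -> R) : (forall j, f j.+1 <= f j) ->
    forall i j, (i <= j)%N -> f j <= f i.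
  by move=> df; apply: (@homo_leq _ _ (fun x y => y <= x)) => // x y z yx zx;
    rewrite (le_trans zx).
have ma := mono _ da; have ma' := mono _ da'.
rewrite (eq_bigr (fun i : 'I_n => \sum_(i' < n')
   Num.max 0 (Num.min (a i) (a' i') - Num.max (a i.+1) (a' i'.+1)) * c i)); last first.
  move=> i _; rewrite -mulr_suml sum_overlap//; first by rewrite -a0 ma.
  by rewrite -an ma.
rewrite exchange_big; apply: eq_bigr => i' _ /=.
rewrite (eq_bigr (fun i : 'I_n =>
   Num.max 0 (Num.min (a' i') (a i) - Num.max (a' i'.+1) (a i.+1)) * c' i')).
  rewrite -mulr_suml sum_overlap//; first by rewrite a0 ma'.
  by rewrite an ma'.
move=> i _; rewrite minC (maxC (a i.+1)).
case: ltP => l0; last by rewrite !mul0r.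
congr (_ * _); move: l0; rewrite subr_gt0 lt_min !gt_max.
move=> /andP[/andP[h1 h2] /andP[h3 h4]].
(* The values are assumed to agree only at points interior to both intervals; the midpoint of the
   nonempty overlap is one. *)
pose th := (Num.max (a i.+1) (a' i'.+1) + Num.min (a i) (a' i')) / 2.
apply: (cc i i' th); rewrite /th.
all: case: (leP (a i.+1) (a' i'.+1)) => ?; case: (leP (a i) (a' i')) => ?; lra.
Qed.

(** * The simplices of T_K *)

Lemma normr_coord_le (R : realType) (n : nat) (x : 'cV[R]_n) k :
  `|x k 0| <= `|x|.
Proof.
rewrite [leRHS]/Num.Def.normr/= mx_normrE.
exact: (le_bigmax _ (fun ij : 'I_n * 'I_1 => `|x ij.1 ij.2|) (k, 0)).
Qed.

Lemma normr_coord_attained (R : realType) (n : nat) (x : 'cV[R]_n.+1) :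
  exists k, `|x| = `|x k 0|.
Proof.
have [x0|x0] := eqVneq `|x| 0.
  exists ord0; apply/eqP; rewrite x0 eq_sym normr_eq0.
  by move/eqP: x0; rewrite normr_eq0 => /eqP ->; rewrite mxE.
have [[k j] /= xE] := mx_norm_neq0 x0.
by exists k; rewrite [LHS]xE (ord1 j).
Qed.

(** Coordinate k is raised in step [(si_rho nu)^-1 k], counted from 0, hence before vertex j exactly
    when this number is below j. *)
Lemma std_vertexE (R : realType) (n : nat) (nu : simplex_index n) j k :
  std_vertex R nu j k 0 = (-1) ^+ (k \in si_J nu) *
    (si_z nu k ord0 + ((si_rho nu)^-1%g k < j))%N%:R.
Proof.
rewrite /std_vertex !mxE summxE.
have -> : \sum_(i < n | (i < j)%N) (delta_mx (si_rho nu i) 0 : 'cV[R]_n) k 0 =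
    ((si_rho nu)^-1%g k < j)%N%:R.
  rewrite (eq_bigr (fun i => (i == (si_rho nu)^-1%g k)%:R)); last first.
    by move=> i _; rewrite !mxE eqxx andbT -(canF_eq (permK _)) eq_sym.
  case: ltnP => h; last first.
    by rewrite big1// => i ij; case: eqP => // ie; rewrite ie ltnNge h in ij.
  rewrite (bigD1 ((si_rho nu)^-1%g k))//= eqxx big1 ?addr0// => i /andP[_].
  by move/negbTE->.
by rewrite natrD; case: ifP => _; rewrite ?expr0 ?expr1 ?mul1r ?mulN1r.
Qed.

Lemma normr_std_vertex_coord (R : realType) (n : nat) (nu : simplex_index n) j k :
  `|std_vertex R nu j k 0| = (si_z nu k ord0 + ((si_rho nu)^-1%g k < j))%N%:R.
Proof. by rewrite std_vertexE normrM normrX normrN1 expr1n mul1r normr_nat. Qed.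

Lemma normr_std_vertex_mono (R : realType) (n : nat)
    (nu : simplex_index n.+1) i j : (i <= j)%N ->
  `|std_vertex R nu i| <= `|std_vertex R nu j|.
Proof.
move=> ij; have [k ->] := normr_coord_attained (std_vertex R nu i).
apply: le_trans (normr_coord_le _ k).
rewrite !normr_std_vertex_coord ler_nat leq_add2l.
by case: ltnP => // h; rewrite (leq_trans h ij).
Qed.

(** Norms of the vertices are nondecreasing in the index, so the vertex inside the cube has index 0
    and every entry of z is below K. The next vertex differs from it only in coordinate
    [si_rho nu ord0], which must therefore reach K. *)
Lemma TKP (R : realType) (n K : nat) (nu : simplex_index n.+1) :
  TK R K nu <->
  (forall k, (si_z nu k ord0 < K)%N) /\ (si_z nu (si_rho nu ord0) ord0).+1 = K.
Proof.
split=> [[_ [j0 [j0K j0uniq]] vK]|[zK z0]].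
  have n0K : `|std_vertex R nu 0| < K%:R.
    by rewrite (le_lt_trans _ j0K)// normr_std_vertex_mono.
  have j00 : j0 = ord0 by apply: j0uniq.
  have zK k : (si_z nu k ord0 < K)%N.
    rewrite -(ltr_nat R) (le_lt_trans _ n0K)//.
    by rewrite (le_trans _ (normr_coord_le _ k))// normr_std_vertex_coord ltn0 addn0.
  split=> //.
  pose j1 : 'I_n.+2 := lift ord0 ord0.
  have n1K : `|std_vertex R nu j1| = K%:R.
    by apply: vK => /j0uniq; rewrite j00 => /(congr1 val).
  have [k] := normr_coord_attained (std_vertex R nu j1).
  rewrite n1K normr_std_vertex_coord => /eqP; rewrite eqr_nat => /eqP Kk.
  move: Kk; case: ltnP => [|_ Kk]; last by move: (zK k); rewrite Kk addn0 ltnn.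
  rewrite ltnS leqn0 => /eqP k0 Kk.
  have -> : si_rho nu ord0 = k.
    by rewrite -[k in RHS](permKV (si_rho nu)); congr (si_rho nu _); apply: val_inj.
  by rewrite Kk addn1.
have coord_le j k : `|std_vertex R nu j k 0| <= K%:R.
  rewrite normr_std_vertex_coord ler_nat; apply: leq_trans (zK k).
  by rewrite -[leqRHS]addn1 leq_add2l leq_b1.
have norm_le j : `|std_vertex R nu j| <= K%:R.
  by have [k ->] := normr_coord_attained (std_vertex R nu j).
have norm0 : `|std_vertex R nu 0| < K%:R.
  have [k ->] := normr_coord_attained (std_vertex R nu 0).
  by rewrite normr_std_vertex_coord ltn0 addn0 ltr_nat.
have normS j : `|std_vertex R nu j.+1| = K%:R.
  apply/eqP; rewrite eq_le norm_le /=.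
  apply: le_trans (normr_coord_le _ (si_rho nu ord0)).
  by rewrite normr_std_vertex_coord permK/= addn1 z0.
split.
- move=> x [l [l0 l1 ->]] k.
  rewrite -ler_norml summxE; apply: le_trans (ler_norm_sum _ _ _) _.
  have -> : K%:R = \sum_j l j * K%:R by rewrite -mulr_suml l1 mul1r.
  apply: ler_sum => j _.
  by rewrite mxE normrM (ger0_norm (l0 j)); apply: (ler_wpM2l (l0 j)); exact: coord_le.
- exists ord0; split=> [|j]; first exact: norm0.
  have [j' ->|->//] := unliftP ord0 j.
  by rewrite normS ltxx.
- move=> j; have [j' ->|->//] := unliftP ord0 j.
  by rewrite normS.
Qed.

(** * Conic combinations of the vertices of a simplex *)

(** The break points T_i of the step function; i ranges over [nat] so that the last one, T_n = 0, is
    included. *)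
Definition tail_sum (R : realType) (n : nat) (m : 'I_n -> R) (i : nat) : R :=
  \sum_(j < n | (i <= j)%N) m j.

Lemma tail_sum0 (R : realType) (n : nat) (m : 'I_n -> R) :
  tail_sum m 0 = \sum_j m j.
Proof. exact: eq_bigl. Qed.

Lemma tail_sum_size (R : realType) (n : nat) (m : 'I_n -> R) :
  tail_sum m n = 0.
Proof. by apply: big_pred0 => j; rewrite leqNgt ltn_ord. Qed.

Lemma tail_sumB (R : realType) (n : nat) (m : 'I_n -> R) (j : 'I_n) :
  tail_sum m j - tail_sum m j.+1 = m j.
Proof.
rewrite /tail_sum (bigD1 j)//= (eq_bigl (fun i : 'I_n => (j < i)%N)) ?addrK//.
by move=> i; rewrite ltn_neqAle andbC eq_sym.
Qed.

Lemma tail_sum_ge0 (R : realType) (n : nat) (m : 'I_n -> R) (i : nat) :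
  (forall j, 0 <= m j) -> 0 <= tail_sum m i.
Proof. by move=> m0; apply: sumr_ge0. Qed.

Lemma tail_sum_mono (R : realType) (n : nat) (m : 'I_n -> R) (i j : nat) :
  (forall j, 0 <= m j) -> (i <= j)%N -> tail_sum m j <= tail_sum m i.
Proof.
move=> m0 ij; rewrite /tail_sum [leRHS](bigID (fun k : 'I_n => (j <= k)%N))/=.
rewrite (eq_bigl (fun k : 'I_n => (i <= k)%N && (j <= k)%N)).
  by rewrite lerDl sumr_ge0.
by move=> k; case: (leqP j k) => h; rewrite ?andbF// (leq_trans ij h).
Qed.

(** Every vertex contributes the base value of coordinate k, and those from the raising step of k
    onwards contribute one unit more; the weights of the latter add up to a tail sum. *)
Lemma cone_coord (R : realType) (n : nat) (nu : simplex_index n)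
    (m : 'I_n -> R) k :
  (\sum_j m j *: std_vertex R nu j.+1) k 0 = (-1) ^+ (k \in si_J nu) *
    (tail_sum m 0 * (si_z nu k ord0)%:R + tail_sum m ((si_rho nu)^-1%g k)).
Proof.
rewrite summxE tail_sum0 mulr_suml mulrDr !mulr_sumr.
rewrite [X in _ = _ + X]big_mkcond -big_split /=; apply: eq_bigr => j _.
rewrite mxE std_vertexE ltnS natrD.
by case: leqP => _ /=; ring.
Qed.

Lemma norm_cone_coord (R : realType) (n : nat) (nu : simplex_index n)
    (m : 'I_n -> R) k : (forall j, 0 <= m j) ->
  `|(\sum_j m j *: std_vertex R nu j.+1) k 0| =
    tail_sum m 0 * (si_z nu k ord0)%:R + tail_sum m ((si_rho nu)^-1%g k).
Proof.
move=> m0; rewrite cone_coord normrM normrX normrN1 expr1n mul1r ger0_norm//.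
by rewrite addr_ge0 ?mulr_ge0 ?tail_sum_ge0.
Qed.

Lemma cone_coord_sign (R : realType) (n : nat) (nu : simplex_index n)
    (m : 'I_n -> R) k : (forall j, 0 <= m j) ->
  let x := \sum_j m j *: std_vertex R nu j.+1 in
  x k 0 = (-1) ^+ (k \in si_J nu) * `|x k 0|.
Proof. by move=> m0 /=; rewrite norm_cone_coord// -cone_coord. Qed.

(* For generic th the absolute value of the k-th coordinate of the vertex is
   the ceiling of (`|x k 0| - th) / S, a quantity which depends on x only. *)
Lemma vertex_level (R : realType) (n : nat) (nu : simplex_index n)
    (m : 'I_n -> R) (j : 'I_n) (th : R) k :
  (forall j, 0 <= m j) -> tail_sum m j.+1 < th < tail_sum m j ->
  let x := \sum_j m j *: std_vertex R nu j.+1 in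
  let a := `|std_vertex R nu j.+1 k 0| in
  tail_sum m 0 * (a - 1) < `|x k 0| - th < tail_sum m 0 * a.
Proof.
move=> m0 /andP[th1 th2] /=; rewrite norm_cone_coord// normr_std_vertex_coord.
have T0 := tail_sum_mono m0 (leq0n ((si_rho nu)^-1%g k)).
have Tj0 := tail_sum_mono m0 (leq0n j).
have Tk0 := tail_sum_ge0 ((si_rho nu)^-1%g k) m0.
have T1 := tail_sum_ge0 j.+1 m0.
rewrite natrD ltnS; set i := (si_rho nu)^-1%g k in T0 Tk0 *.
(* If i <= j then T_i >= T_j > th; otherwise T_i <= T_{j+1} < th. *)
case: leqP => h /=.
  by have := tail_sum_mono m0 h; lra.
by have := tail_sum_mono m0 h; lra.
Qed.

(** Both a and b are the ceiling of t / s. *)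
Lemma nat_between_unique (R : realType) (s t : R) (a b : nat) : 0 < s ->
  s * (a%:R - 1) < t < s * a%:R -> s * (b%:R - 1) < t < s * b%:R -> a = b.
Proof.
move=> s0; suff le c d : s * (c%:R - 1) < t -> t < s * d%:R -> (c <= d)%N.
  by move=> /andP[a1 a2] /andP[b1 b2]; apply/eqP; rewrite eqn_leq !le.
move=> h1 h2; have := lt_trans h1 h2; rewrite ltr_pM2l// ltrBlDr.
by rewrite -[X in _ + X]/(1%:R) -natrD ltr_nat addn1 ltnS.
Qed.

(** By [vertex_level] the absolute values of the coordinates are determined by x, th and T_0, which
    the two sides share; the signs are those of x. *)
Lemma cone_vertex_eq (R : realType) (n : nat) (nu nu' : simplex_index n)
    (m m' : 'I_n -> R) (j j' : 'I_n) (th : R) :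
  (forall j, 0 <= m j) -> (forall j, 0 <= m' j) ->
  \sum_j m j *: std_vertex R nu j.+1 = \sum_j m' j *: std_vertex R nu' j.+1 ->
  tail_sum m 0 = tail_sum m' 0 ->
  tail_sum m j.+1 < th < tail_sum m j ->
  tail_sum m' j'.+1 < th < tail_sum m' j' ->
  std_vertex R nu j.+1 = std_vertex R nu' j'.+1.
Proof.
move=> m0 m'0 xx' S thj thj'; apply/colP => k.
have S0 : 0 < tail_sum m 0.
  have /andP[h1 h2] := thj; have := tail_sum_mono m0 (leq0n j).
  by have := tail_sum_ge0 j.+1 m0; lra.
have th0 : 0 < th.
  by have /andP[h1 h2] := thj; have := tail_sum_ge0 j.+1 m0; lra.
have /= h := vertex_level nu k m0 thj.
have /= h' := vertex_level nu' k m'0 thj'.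
rewrite -xx' -S in h'; rewrite !normr_std_vertex_coord in h h'.
have aa := nat_between_unique S0 h h'.
rewrite !std_vertexE aa.
have /= e := cone_coord_sign nu k m0.
have /= := cone_coord_sign nu' k m'0; rewrite -xx' {1}e => ee.
(* Where x vanishes the two reflections may differ, but the level is then 0: a positive level would
   make - th positive. *)
have [x0|x0] := eqVneq ((\sum_j m j *: std_vertex R nu j.+1) k 0) 0.
  rewrite x0 normr0 in h'.
  suff -> : (si_z nu' k ord0 + ((si_rho nu')^-1%g k < j'.+1) = 0)%N.
    by rewrite !mulr0.
  move: h' => /andP[+ _]; rewrite sub0r => h1.
  have : tail_sum m 0 * ((si_z nu' k ord0 + ((si_rho nu')^-1%g k < j'.+1))%N%:R - 1)
      < tail_sum m 0 * 0.
    by rewrite mulr0 (lt_trans h1)// oppr_lt0.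
  by rewrite ltr_pM2l// subr_lt0 -[1]/(1%:R) ltr_nat ltnS leqn0 => /eqP.
by congr (_ * _); apply: (@mulIf _ `|(\sum_j m j *: std_vertex R nu j.+1) k 0|) => //;
  rewrite normr_eq0.
Qed.

(** The outer vertices all have absolute value K in coordinate [si_rho nu ord0], so they lie on one
    face of the cube, and the maximum norm is linear on the cone over a face. Thus x determines
    T_0. *)
Lemma norm_TK_cone (R : realType) (n K : nat) (nu : simplex_index n.+1)
    (m : 'I_n.+1 -> R) : TK R K nu -> (forall j, 0 <= m j) ->
  `|\sum_j m j *: std_vertex R nu j.+1| = K%:R * \sum_j m j.
Proof.
move=> /TKP[zK z0] m0; rewrite -tail_sum0; apply/eqP; rewrite eq_le; apply/andP; split.
  have [k ->] := normr_coord_attained (\sum_j m j *: std_vertex R nu j.+1).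
  rewrite norm_cone_coord// mulrC.
  have := tail_sum_mono m0 (leq0n ((si_rho nu)^-1%g k)).
  have S0 := tail_sum_ge0 0 m0 => h.
  apply: (@le_trans _ _ (tail_sum m 0 * (si_z nu k ord0).+1%:R)).
    by rewrite -[in leRHS]natr1; lra.
  by rewrite mulrC ler_wpM2r// ler_nat.
apply: le_trans (normr_coord_le _ (si_rho nu ord0)).
by rewrite norm_cone_coord// permK -[in leLHS]z0 -natr1 /=; lra.
Qed.

(** Both step functions live on ]0, T_0[ with the same T_0 by [norm_TK_cone], and agree off the
    break points by [cone_vertex_eq]. *)
Lemma cone_sum_unique (R : realType) (n K : nat) (nu nu' : simplex_index n.+1)
    (m m' : 'I_n.+1 -> R) (G : 'cV[R]_n.+1 -> R) :
  TK R K nu -> TK R K nu' -> (forall j, 0 <= m j) -> (forall j, 0 <= m' j) ->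
  \sum_j m j *: std_vertex R nu j.+1 = \sum_j m' j *: std_vertex R nu' j.+1 ->
  \sum_j m j * G (std_vertex R nu j.+1) =
  \sum_j m' j * G (std_vertex R nu' j.+1).
Proof.
move=> nuK nuK' m0 m'0 xx'.
have K0 : K%:R != 0 :> R.
  by move/TKP : nuK => [/(_ ord0) + _]; rewrite pnatr_eq0 -lt0n; apply: leq_trans.
have S : tail_sum m 0 = tail_sum m' 0.
  apply: (mulfI K0); rewrite !tail_sum0.
  by rewrite -(norm_TK_cone nuK)// xx' (norm_TK_cone nuK').
have mono (l : 'I_n.+1 -> R) : (forall j, 0 <= l j) ->
    forall j, tail_sum l j.+1 <= tail_sum l j.
  by move=> l0 j; exact: tail_sum_mono.
under eq_bigr do rewrite -tail_sumB.
under [RHS]eq_bigr do rewrite -tail_sumB.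
apply: (step_sum_unique (c := fun j => G (std_vertex R nu j.+1))
  (c' := fun j => G (std_vertex R nu' j.+1)) (mono _ m0) (mono _ m'0) S) => //.
  by rewrite !tail_sum_size.
by move=> i i' th h h'; congr G; exact: cone_vertex_eq h h'.
Qed.

(** * Finding a cone that contains a given point *)

(** The order is decreasing because coordinates with larger fractional part have to be raised
    earlier. *)
Lemma sorting_perm (R : realType) (n : nat) (f : 'I_n -> R) :
  exists rho : 'S_n, forall i j : 'I_n, (i <= j)%N -> f (rho j) <= f (rho i).
Proof.
pose t := [tuple f i | i < n].
have /tuple_permP[rho rhoE] : perm_eq (sort >=%O t) t by rewrite perm_sort.
exists rho => i j ij.
have nthE (k : 'I_n) : nth 0 (sort >=%O t) k = f (rho k).
  by rewrite rhoE -tnth_nth !tnth_mktuple.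
have ge_tr : transitive (>=%O : rel R) by move=> x y z /= yx xz; exact: le_trans xz yx.
have srt : sorted (>=%O : rel R) (sort >=%O t).
  by apply: sort_sorted => x y; rewrite /= orbC le_total.
have ge_refl : reflexive (>=%O : rel R) by move=> x /=; exact: lexx.
rewrite -!nthE; apply: (sorted_leq_nth ge_tr ge_refl 0 srt) => //.
- by rewrite inE size_sort size_tuple.
- by rewrite inE size_sort size_tuple.
Qed.

Lemma tail_sum_telescope (R : realType) (n : nat) (t : nat -> R) (i : nat) :
  (i <= n)%N -> tail_sum (fun j : 'I_n => t j - t j.+1) i = t i - t n.
Proof.
move=> lin; rewrite /tail_sum.
rewrite -(big_geq_mkord i n xpredT (fun j => t j - t j.+1)).
under eq_bigr do rewrite -opprB.
by rewrite sumrN telescope_sumr// opprB.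
Qed.

Lemma TK_nonempty (R : realType) (n K : nat) : (0 < K)%N ->
  exists nu : simplex_index n.+1, TK R K nu.
Proof.
move=> K0; exists (SimplexIndex (const_mx K.-1) finset.set0 1%g).
by apply/TKP; split=> [k|] /=; rewrite mxE prednK.
Qed.

(** After scaling x to maximum norm K, z collects the integer parts of the |x_k| and rho sorts the
    fractional parts. Scaled back, these are the tail sums, and the weights are their successive
    differences. *)
Lemma cone_cover (R : realType) (n K : nat) (x : 'cV[R]_n.+1) : (0 < K)%N ->
  exists2 nu : simplex_index n.+1, TK R K nu &
    exists m : 'I_n.+1 -> R, (forall j, 0 <= m j) /\
      x = \sum_j m j *: std_vertex R nu j.+1.
Proof.
move=> K0.
have [->|x0] := eqVneq x 0.
  have [nu nuK] := TK_nonempty R n K0; exists nu => //.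
  by exists (fun=> 0); split=> //; rewrite big1// => j _; rewrite scale0r.
have KR : 0 < K%:R :> R by rewrite ltr0n.
pose s := `|x| / K%:R.
have s0 : 0 < s by rewrite divr_gt0// normr_gt0.
pose u k := `|x k 0| / s.
have u0 k : 0 <= u k by rewrite divr_ge0// ltW.
have uK k : u k <= K%:R.
  by rewrite ler_pdivrMr// mulrC divfK ?gt_eqF// normr_coord_le.
(* The cap at K - 1 gives a coordinate with u k = K the fractional part 1 instead of 0, which keeps
   the base vertex inside the cube. *)
pose z k := minn (Num.truncn (u k)) K.-1.
pose f k := u k - (z k)%:R.
have f0 k : 0 <= f k.
  rewrite subr_ge0; apply: le_trans (_ : (Num.truncn (u k))%:R <= _).
    by rewrite ler_nat geq_minl.
  by rewrite truncn_le.
have f1 k : f k <= 1.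
  rewrite lerBlDl natr1 /z; case: leqP => h; last by rewrite prednK.
  by rewrite ltW// truncnS_gt.
have f1z k : 1 <= f k -> (z k).+1 = K.
  rewrite lerBrDl natr1 /z; case: leqP => h; last by rewrite prednK.
  by rewrite leNgt truncnS_gt.
have [rho rho_sort] := sorting_perm f.
(* A coordinate attaining the norm of x has fractional part 1, the largest possible. Having 1 in
   first place gives the second condition of [TKP], through [f1z], and makes T_0 equal to s. *)
have f_rho0 : f (rho ord0) = 1.
  apply/eqP; rewrite eq_le f1 /=.
  have [k xk] := normr_coord_attained x.
  apply: le_trans (_ : f k <= _); last first.
    by rewrite -[k](permKV rho) rho_sort.
  have uk : u k = K%:R.
    by rewrite /u -xk /s invf_div mulrCA divff ?mulr1// normr_eq0.
  by rewrite /f uk lerBrDl natr1 ler_nat -[leqRHS](prednK K0) ltnS geq_minr.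
pose nu := SimplexIndex (\col_k z k) (finset.finset (fun k => x k 0 < 0)) rho.
exists nu.
  apply/TKP; split=> [k|] /=; rewrite mxE; last by rewrite f1z// f_rho0.
  by rewrite -[ltnRHS](prednK K0) ltnS geq_minr.
(* The intended tail sums, extended by 0 so that the last difference is the last weight. *)
pose t i := if (i < n.+1)%N then s * f (rho (inord i)) else 0.
have tn : t n.+1 = 0 by rewrite /t ltnn.
have tE (i : 'I_n.+1) : t i = s * f (rho i) by rewrite /t ltn_ord inord_val.
exists (fun j => t j - t j.+1); split=> [j|].
  rewrite subr_ge0 tE /t; case: ltnP => h; last by rewrite mulr_ge0// ltW.
  by rewrite ler_wpM2l ?(ltW s0)// rho_sort// inordK.
apply/colP => k; rewrite cone_coord !tail_sum_telescope//; last exact/ltnW.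
rewrite tn !subr0 (tE ord0) f_rho0 mulr1 /= mxE tE permKV.
have -> : s * (z k)%:R + s * f k = `|x k 0|.
  by rewrite -mulrDr addrC subrK mulrC divfK ?gt_eqF.
rewrite inE.
case: ltP => xk; first by rewrite ltr0_norm// expr1 mulN1r opprK.
by rewrite ger0_norm// mul1r.
Qed.

(** * The fan of cones over T_K^F *)

Lemma enorm_ge0 (R : realType) (n : nat) (x : 'cV[R]_n) : 0 <= enorm x.
Proof. exact: sqrtr_ge0. Qed.

Lemma sqr_enorm (R : realType) (n : nat) (x : 'cV[R]_n) :
  enorm x ^+ 2 = \sum_k x k 0 ^+ 2.
Proof. by rewrite sqr_sqrtr// sumr_ge0// => k _; rewrite sqr_ge0. Qed.

Lemma enorm0 (R : realType) (n : nat) : enorm (0 : 'cV[R]_n) = 0.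
Proof.
by rewrite /enorm big1 ?sqrtr0// => k _; rewrite mxE expr0n.
Qed.

Lemma normr_coord_le_enorm (R : realType) (n : nat) (x : 'cV[R]_n) k :
  `|x k 0| <= enorm x.
Proof.
rewrite -ler_sqr ?nnegrE ?enorm_ge0// sqr_enorm real_normK ?num_real//.
by rewrite (bigD1 k)//= lerDl sumr_ge0// => j _; rewrite sqr_ge0.
Qed.

Lemma enorm_gt0 (R : realType) (n : nat) (x : 'cV[R]_n) :
  (0 < enorm x) = (x != 0).
Proof.
apply/idP/idP => [|x0]; first by apply: contraTneq => ->; rewrite enorm0 ltxx.
rewrite lt_neqAle enorm_ge0 andbT eq_sym; apply: contra x0 => /eqP e0.
apply/eqP/colP => k; rewrite mxE; apply/eqP; rewrite -normr_le0 -e0.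
exact: normr_coord_le_enorm.
Qed.

Lemma enormZ (R : realType) (n : nat) (a : R) (x : 'cV[R]_n) :
  enorm (a *: x) = `|a| * enorm x.
Proof.
apply/eqP; rewrite -(@eqrXn2 _ 2)// ?mulr_ge0 ?enorm_ge0//.
rewrite exprMn !sqr_enorm real_normK ?num_real// mulr_sumr.
by apply/eqP/eq_bigr => k _; rewrite mxE exprMn.
Qed.

Lemma enormD (R : realType) (n : nat) (x y : 'cV[R]_n) :
  enorm (x + y) <= enorm x + enorm y.
Proof.
have [->|x0] := eqVneq x 0; first by rewrite add0r enorm0 add0r.
have [->|y0] := eqVneq y 0; first by rewrite addr0 enorm0 addr0.
move: x0 y0; rewrite -!enorm_gt0 => x0 y0.
rewrite -ler_sqr ?nnegrE ?addr_ge0 ?enorm_ge0//.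
set a := enorm x in x0 *; set b := enorm y in y0 *.
have aE : a ^+ 2 = \sum_k x k 0 ^+ 2 by exact: sqr_enorm.
have bE : b ^+ 2 = \sum_k y k 0 ^+ 2 by exact: sqr_enorm.
(* AM-GM: [2 x_k y_k <= x_k^2 b / a + y_k^2 a / b] *)
apply: (@le_trans _ _ (\sum_k ((1 + b / a) * x k 0 ^+ 2 + (1 + a / b) * y k 0 ^+ 2))).
  rewrite sqr_enorm; apply: ler_sum => k _; rewrite mxE -subr_ge0.
  have -> : (1 + b / a) * x k 0 ^+ 2 + (1 + a / b) * y k 0 ^+ 2 -
      (x k 0 + y k 0) ^+ 2 = (b * x k 0 - a * y k 0) ^+ 2 / (a * b).
    by field; rewrite !gt_eqF.
  by rewrite divr_ge0 ?sqr_ge0// mulr_ge0// ltW.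
rewrite big_split/= -!mulr_sumr -aE -bE le_eqVlt; apply/orP; left; apply/eqP.
by field; rewrite !gt_eqF.
Qed.

Lemma enorm_sum_le (R : realType) (n m : nat) (l : 'I_m -> R)
    (v : 'I_m -> 'cV[R]_n) : (forall j, 0 <= l j) ->
  enorm (\sum_j l j *: v j) <= \sum_j l j * enorm (v j).
Proof.
move=> l0; elim/big_ind2 : _ => [|x a y b xa yb|j _]; first by rewrite enorm0.
  exact: le_trans (enormD _ _) (lerD xa yb).
by rewrite enormZ ger0_norm.
Qed.

Lemma TK_gt0 (R : realType) (n K : nat) (nu : simplex_index n.+1) :
  TK R K nu -> (0 < K)%N.
Proof. by move/TKP => [/(_ ord0) + _]; apply: leq_trans. Qed.

Lemma norm_TK_vertex (R : realType) (n K : nat) (nu : simplex_index n.+1)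
    (j : 'I_n.+1) : TK R K nu -> `|std_vertex R nu j.+1| = K%:R.
Proof.
move=> nuK; have := norm_TK_cone nuK (m := fun i => (i == j)%:R) (fun=> ler0n _ _).
rewrite (bigD1 j)//= big1 => [|i /negbTE->]; last by rewrite scale0r.
rewrite eqxx scale1r addr0 => ->.
by rewrite (bigD1 j)//= big1 => [|i /negbTE->//]; rewrite eqxx addr0 mulr1.
Qed.

(** The factor by which F stretches a nonzero vector. F preserves rays, so T_K and T_K^F span the
    same cones and only the weights change. *)
Definition fan_scale (R : realType) (n : nat) (y : 'cV[R]_n) : R :=
  enorm y / `|y|.

Lemma fan_vertexE (R : realType) (n K : nat) (nu : simplex_index n.+1)
    (j : 'I_n.+1) : TK R K nu ->
  let y := std_vertex R nu j.+1 in
  0 < fan_scale y /\ fan_vertex R nu j = fan_scale y *: y.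
Proof.
move=> nuK /=.
have n0 : std_vertex R nu j.+1 != 0.
  by rewrite -normr_gt0 (norm_TK_vertex _ nuK) ltr0n (TK_gt0 nuK).
by rewrite /fan_scale divr_gt0 ?enorm_gt0 ?normr_gt0// /fan_vertex /Fmap (negbTE n0).
Qed.

Lemma fan_cover (R : realType) (n K : nat) (x : 'cV[R]_n.+1) : (0 < K)%N ->
  exists2 nu : simplex_index n.+1, TK R K nu &
    exists l : 'I_n.+1 -> R, (forall j, 0 <= l j) /\
      x = \sum_j l j *: fan_vertex R nu j.
Proof.
move=> /(cone_cover x)[nu nuK [m [m0 ->]]]; exists nu => //.
exists (fun j => m j / fan_scale (std_vertex R nu j.+1)); split=> [j|].
  by have [s0 _] := fan_vertexE j nuK; rewrite divr_ge0// ltW.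
apply: eq_bigr => j _; have [s0 ->] := fan_vertexE j nuK.
by rewrite scalerA divfK// gt_eqF.
Qed.

(** Moving [fan_scale] into the weights yields combinations over T_K; [G'] divides the factor out
    again, which reduces the claim to [cone_sum_unique]. *)
Lemma fan_sum_unique (R : realType) (n K : nat) (nu nu' : simplex_index n.+1)
    (l l' : 'I_n.+1 -> R) (G : 'cV[R]_n.+1 -> R) :
  TK R K nu -> TK R K nu' -> (forall j, 0 <= l j) -> (forall j, 0 <= l' j) ->
  \sum_j l j *: fan_vertex R nu j = \sum_j l' j *: fan_vertex R nu' j ->
  \sum_j l j * G (fan_vertex R nu j) = \sum_j l' j * G (fan_vertex R nu' j).
Proof.
move=> nuK nuK' l0 l'0 xx'.
pose m (mu : simplex_index n.+1) (w : 'I_n.+1 -> R) j :=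
  w j * fan_scale (std_vertex R mu j.+1).
have mE mu w : TK R K mu ->
    \sum_j w j *: fan_vertex R mu j = \sum_j m mu w j *: std_vertex R mu j.+1.
  by move=> muK; apply: eq_bigr => j _; have [_ ->] := fan_vertexE j muK;
    rewrite scalerA.
pose G' y := G (Fmap y) / fan_scale y.
have GE mu w : TK R K mu -> \sum_j w j * G (fan_vertex R mu j) =
    \sum_j m mu w j * G' (std_vertex R mu j.+1).
  move=> muK; apply: eq_bigr => j _; have [s0 _] := fan_vertexE j muK.
  by rewrite /m /G' -mulrA (mulrCA (fan_scale _)) divff ?mulr1// gt_eqF.
have m0 mu w : TK R K mu -> (forall j, 0 <= w j) -> forall j, 0 <= m mu w j.
  by move=> muK w0 j; have [s0 _] := fan_vertexE j muK; rewrite mulr_ge0// ltW.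
rewrite !GE//; apply: (cone_sum_unique G' nuK nuK'); [exact: m0|exact: m0|].
by rewrite -(mE _ _ nuK) -(mE _ _ nuK').
Qed.

(** * Independence of the vertices and the linear pieces *)

(** By [cone_coord] the coordinate raised first gives K T_0 = 0, and then each coordinate makes its
    tail sum vanish. The weights are differences of tail sums. *)
Lemma std_vertex_free (R : realType) (n K : nat) (nu : simplex_index n.+1)
    (m : 'I_n.+1 -> R) : TK R K nu ->
  \sum_j m j *: std_vertex R nu j.+1 = 0 -> forall j, m j = 0.
Proof.
move=> nuK s0; have [zK z0] := (TKP R K nu).1 nuK.
have T k : tail_sum m 0 * (si_z nu k ord0)%:R + tail_sum m ((si_rho nu)^-1%g k) = 0.
  have := cone_coord nu m k; rewrite s0 mxE => /esym/eqP.
  by rewrite mulf_eq0 signr_eq0 => /eqP.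
have S0 : tail_sum m 0 = 0.
  have := T (si_rho nu ord0); rewrite permK /= -[X in _ + X]mulr1 -mulrDr natr1 z0.
  move/eqP; rewrite mulf_eq0 pnatr_eq0 => /orP[/eqP//|K0].
  by have := TK_gt0 nuK; rewrite lt0n K0.
have T0 i : (i <= n.+1)%N -> tail_sum m i = 0.
  rewrite leq_eqVlt => /orP[/eqP->|ltin]; first exact: tail_sum_size.
  have := T (si_rho nu (Ordinal ltin)).
  by rewrite permK S0 mul0r add0r.
by move=> j; rewrite -tail_sumB !T0 ?subrr// ltnW.
Qed.

Lemma Xmat_mulmx (R : realType) (n : nat) (nu : simplex_index n)
    (c : 'cV[R]_n) : Xmat R nu *m c = \sum_j c j 0 *: fan_vertex R nu j.
Proof.
apply/colP => k; rewrite mxE summxE; apply: eq_bigr => j _.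
by rewrite !mxE mulrC.
Qed.

Lemma Xmat_unit (R : realType) (n K : nat) (nu : simplex_index n.+1) :
  TK R K nu -> Xmat R nu \in unitmx.
Proof.
move=> nuK; rewrite -unitmx_tr -row_free_unit; apply: inj_row_free => v.
move=> /(congr1 trmx); rewrite trmx_mul trmxK trmx0 Xmat_mulmx => vX.
apply/rowP => j; rewrite [RHS]mxE.
have := std_vertex_free (m := fun j => v^T j 0 * fan_scale (std_vertex R nu j.+1)) nuK.
move/(_ _ j); rewrite mxE => /(_ _)/eqP; rewrite mulf_eq0.
have [s0 _] := fan_vertexE j nuK; rewrite (gt_eqF s0) orbF => h.
apply/eqP/h; rewrite -[RHS]vX; apply: eq_bigr => i _.
by have [_ ->] := fan_vertexE i nuK; rewrite scalerA.
Qed.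

(** Coordinates in the basis of nonzero vertices, written with the inverse matrix that constraint
    (2) uses. *)
Definition fan_coord (R : realType) (n : nat) (nu : simplex_index n)
    (x : 'cV[R]_n) (j : 'I_n) : R := (invmx (Xmat R nu) *m x) j 0.

Definition fan_cone (R : realType) (n : nat) (nu : simplex_index n) :
    set 'cV[R]_n := [set x | forall j, 0 <= fan_coord nu x j].

(* The linear function whose values at the vertices of nu are those of g. *)
Definition fan_piece (R : realType) (n : nat) (g : 'cV[R]_n -> R)
    (nu : simplex_index n) (x : 'cV[R]_n) : R :=
  \sum_j fan_coord nu x j * g (fan_vertex R nu j).

Lemma fan_coordK (R : realType) (n K : nat) (nu : simplex_index n.+1)
    (x : 'cV[R]_n.+1) : TK R K nu ->
  x = \sum_j fan_coord nu x j *: fan_vertex R nu j.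
Proof. by move=> nuK; rewrite -Xmat_mulmx mulKVmx// (Xmat_unit nuK). Qed.

Lemma fan_coord_sum (R : realType) (n K : nat) (nu : simplex_index n.+1)
    (l : 'I_n.+1 -> R) j : TK R K nu ->
  fan_coord nu (\sum_j l j *: fan_vertex R nu j) j = l j.
Proof.
move=> nuK; rewrite /fan_coord.
have -> : \sum_j l j *: fan_vertex R nu j = Xmat R nu *m \col_j l j.
  by rewrite Xmat_mulmx; apply: eq_bigr => i _; rewrite mxE.
by rewrite mulKmx ?(Xmat_unit nuK)// mxE.
Qed.

Lemma fan_cone_cover (R : realType) (n K : nat) (x : 'cV[R]_n.+1) : (0 < K)%N ->
  exists2 nu : simplex_index n.+1, TK R K nu & fan_cone nu x.
Proof.
move=> /(fan_cover x)[nu nuK [l [l0 ->]]]; exists nu => // j.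
by rewrite (fan_coord_sum _ _ nuK).
Qed.

Lemma fan_coordD (R : realType) (n : nat) (nu : simplex_index n)
    (x y : 'cV[R]_n) j : fan_coord nu (x + y) j = fan_coord nu x j + fan_coord nu y j.
Proof. by rewrite /fan_coord mulmxDr mxE. Qed.

Lemma fan_coordZ (R : realType) (n : nat) (nu : simplex_index n)
    (a : R) (x : 'cV[R]_n) j : fan_coord nu (a *: x) j = a * fan_coord nu x j.
Proof. by rewrite /fan_coord -scalemxAr mxE. Qed.

Lemma fan_pieceD (R : realType) (n : nat) (g : 'cV[R]_n -> R)
    (nu : simplex_index n) (x y : 'cV[R]_n) :
  fan_piece g nu (x + y) = fan_piece g nu x + fan_piece g nu y.
Proof.
by rewrite -big_split; apply: eq_bigr => j _; rewrite fan_coordD mulrDl.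
Qed.

Lemma fan_pieceZ (R : realType) (n : nat) (g : 'cV[R]_n -> R)
    (nu : simplex_index n) (a : R) (x : 'cV[R]_n) :
  fan_piece g nu (a *: x) = a * fan_piece g nu x.
Proof.
by rewrite mulr_sumr; apply: eq_bigr => j _; rewrite fan_coordZ mulrA.
Qed.

Lemma fan_pieceB (R : realType) (n : nat) (g : 'cV[R]_n -> R)
    (nu : simplex_index n) (x y : 'cV[R]_n) :
  fan_piece g nu (x - y) = fan_piece g nu x - fan_piece g nu y.
Proof. by rewrite fan_pieceD -scaleN1r fan_pieceZ mulN1r. Qed.

Lemma fan_piece_linear (R : realType) (n : nat) (g : 'cV[R]_n -> R)
    (nu : simplex_index n) : linear_for *%R (fan_piece g nu).
Proof. by move=> a x y; rewrite fan_pieceD fan_pieceZ. Qed.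

HB.instance Definition _ (R : realType) (n : nat) (g : 'cV[R]_n -> R)
    (nu : simplex_index n) :=
  GRing.isLinear.Build R 'cV[R]_n R _ (fan_piece g nu) (fan_piece_linear g nu).

(** By [fan_sum_unique] every choice gives the same value as nu, whose own coordinates are an
    admissible choice. This is the well-definedness of V_i. *)
Lemma interpolantE (R : realType) (n : nat) (P : {fset nat}) (K : nat)
    (Vx : 'cV[R]_n.+1 -> P -> R) (i : P) (nu : simplex_index n.+1)
    (x : 'cV[R]_n.+1) (y : R) :
  TK R K nu -> fan_cone nu x ->
  interpolant K Vx i x y <-> y = fan_piece (Vx^~ i) nu x.
Proof.
move=> nuK nux; split=> [[nu' nuK' [l [l0 xE ->]]]|->].
  apply: (fan_sum_unique (Vx^~ i) nuK' nuK l0 nux).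
  by rewrite -xE -(fan_coordK _ nuK).
exists nu => //; exists (fan_coord nu x); split=> //.
exact: fan_coordK nuK.
Qed.

(** * Continuity and local growth of the interpolant *)

Lemma mulmx_coord_continuous (R : realType) (m n : nat) (M : 'M[R]_(m, n)) j :
  continuous (fun x : 'cV[R]_n => (M *m x) j 0).
Proof.
have -> : (fun x : 'cV[R]_n => (M *m x) j 0) = fun x => \sum_k M j k * x k 0.
  by apply/funext => x; rewrite mxE.
apply: continuous_big => [|k _ x]; first exact: add_continuous.
apply: cvgMl_tmp; first exact: nbhs_filter.
exact: coord_continuous.
Qed.

Lemma fan_coord_continuous (R : realType) (n : nat) (nu : simplex_index n) j :
  continuous (fun x : 'cV[R]_n => fan_coord nu x j).
Proof. exact: mulmx_coord_continuous. Qed.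

Lemma fan_piece_continuous (R : realType) (n : nat) (g : 'cV[R]_n -> R)
    (nu : simplex_index n) : continuous (fan_piece g nu).
Proof.
apply: continuous_big => [|j _ x]; first exact: add_continuous.
apply: cvgMr_tmp; first exact: nbhs_filter.
exact: fan_coord_continuous.
Qed.

(** The index type is infinite, but [TKP] bounds z by K, so a finite type covers the simplices of
    T_K and finitely many filter sets are intersected. *)
Lemma near_TK (R : realType) (n K : nat) (T : Type) (F : set_system T)
    (Q : simplex_index n.+1 -> set T) : Filter F ->
  (forall nu, TK R K nu -> \forall y \near F, Q nu y) ->
  \forall y \near F, forall nu, TK R K nu -> Q nu y.
Proof.
move=> FF FQ.
pose dec (t : 'cV['I_K]_n.+1 * {set 'I_n.+1} * 'S_n.+1) :=
  SimplexIndex (map_mx (@nat_of_ord K) t.1.1) t.1.2 t.2.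
have h : \forall y \near F, forall t, TK R K (dec t) -> Q (dec t) y.
  apply: filter_forall => t.
  have [tK|tK] := pselect (TK R K (dec t)); last exact: filterE.
  by apply: filterS (FQ _ tK).
apply: filterS h => y h nu nuK; have /TKP[zK _] := nuK.
have nuE : nu = dec (\col_k Ordinal (zK k), si_J nu, si_rho nu).
  case: nu zK {nuK} => z J rho /= zK; congr SimplexIndex.
  by apply/colP => k; rewrite !mxE.
by rewrite nuE; apply: h; rewrite -nuE.
Qed.

(* The cones are closed and finite in number. *)
Lemma near_fan_cone (R : realType) (n K : nat) (x : 'cV[R]_n.+1) :
  \forall y \near x, forall nu, TK R K nu -> fan_cone nu y -> fan_cone nu x.
Proof.
apply: (@near_TK R n K _ (nbhs x)
  (fun nu y => fan_cone nu y -> fan_cone nu x) (nbhs_filter x)) => nu nuK.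
have [nux|nux] := pselect (fan_cone nu x); first exact: filterE.
have [j] : exists j, ~ 0 <= fan_coord nu x j by apply/existsNP.
move/negP; rewrite -ltNge => xj.
have /(@cvgr_lt _ _ _ (nbhs_filter x)) := @fan_coord_continuous R _ nu j x.
move=> /(_ _ xj); apply: filterS => y yj /(_ j).
by rewrite leNgt yj.
Qed.

Definition fan_interpolates (R : realType) (n K : nat)
    (g v : 'cV[R]_n.+1 -> R) : Prop :=
  forall (nu : simplex_index n.+1) (x : 'cV[R]_n.+1),
    TK R K nu -> fan_cone nu x -> v x = fan_piece g nu x.

(** A cone that contains a point y close enough to x also contains x, so any cone covering y serves;
    it may depend on y. *)
Lemma near_common_fan_cone (R : realType) (n K : nat) (x : 'cV[R]_n.+1) :
  (0 < K)%N -> \forall y \near x, exists nu,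
    [/\ TK R K nu, fan_cone nu x & fan_cone nu y].
Proof.
move=> K0; have := near_fan_cone K x.
apply: filterS => y h; have [nu nuK nuy] := fan_cone_cover y K0.
by exists nu; split=> //; exact: h.
Qed.

Lemma fan_interpolates_continuous (R : realType) (n K : nat)
    (g v : 'cV[R]_n.+1 -> R) : (0 < K)%N ->
  fan_interpolates K g v -> continuous v.
Proof.
move=> K0 vg x; apply/(@cvgrPdist_lt _ _ _ _ (nbhs_filter x)) => e e0.
(* The common cone varies with y, so all pieces are controlled at once. *)
have : \forall y \near x, forall nu, TK R K nu ->
    `|fan_piece g nu x - fan_piece g nu y| < e.
  apply: (@near_TK R n K _ (nbhs x) (fun nu y =>
    `|fan_piece g nu x - fan_piece g nu y| < e) (nbhs_filter x)) => nu _.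
  have cont := @fan_piece_continuous R _ g nu x.
  exact: ((@cvgrPdist_lt _ _ _ _ (nbhs_filter x) _ _).1 cont e e0).
apply: filterS2 (near_common_fan_cone x K0) => y [nu [nuK nux nuy]] /(_ _ nuK).
by rewrite (vg nu x)// (vg nu y).
Qed.

(** On a cone shared by phi t and phi (t + h) the increment of v is the linear piece of phi (t + h)
    - phi t, which is close to h d. The bound by c is asked of every cone at phi t because the
    shared one varies with h. A general curve phi covers both flows and switched solutions. *)
Lemma fan_interpolates_growth (R : realType) (n K : nat)
    (g v : 'cV[R]_n.+1 -> R) (phi : R -> 'cV[R]_n.+1) (t c e : R)
    (d : 'cV[R]_n.+1) :
  (0 < K)%N -> fan_interpolates K g v -> is_derive t 1 phi d ->
  (forall nu, TK R K nu -> fan_cone nu (phi t) -> fan_piece g nu d <= c) ->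
  0 < e -> \forall h \near (0 : R)^'+, v (phi (t + h)) <= v (phi t) + h * (c + e).
Proof.
move=> K0 vg phid dc e0.
have quot : h^-1 *: (phi (h + t) - phi t) @[h --> (0 : R)^'+] --> d.
  have /cvg_ex[l phil] := @ex_derive _ _ _ _ _ _ _ phid.
  have dl : d = l by rewrite -(@derive_val _ _ _ _ _ _ _ phid); exact: cvg_lim phil.
  rewrite dl; move/cvg_dnbhs_at_right : phil; apply: cvg_trans.
  by apply: near_eq_cvg; apply: nearW => h /=; rewrite /shift/= [h *: 1]mulr1.
have phic : phi (t + h) @[h --> (0 : R)^'+] --> phi t.
  have phit : {for t, continuous phi}.
    apply: differentiable_continuous; apply/derivable1_diffP.
    exact: (@ex_derive _ _ _ _ _ _ _ phid).
  have th : t + h @[h --> (0 : R)^'+] --> t.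
    rewrite -[X in _ --> X]addr0; apply: cvgD; first exact: cvg_cst.
    by apply: cvg_at_right_filter; exact: cvg_id.
  exact: cvg_comp th phit.
have hpos := nbhs_right_gt (0 : R).
have hcone : \forall h \near (0 : R)^'+, exists nu,
    [/\ TK R K nu, fan_cone nu (phi t) & fan_cone nu (phi (t + h))].
  exact: phic (near_common_fan_cone (phi t) K0).
have hpiece : \forall h \near (0 : R)^'+, forall nu, TK R K nu ->
    fan_cone nu (phi t) -> fan_piece g nu (phi (t + h) - phi t) <= h * (c + e).
  apply: near_TK => nu nuK.
  have [nut|nut] := pselect (fan_cone nu (phi t)); last exact: filterE.
  have dce : fan_piece g nu d < c + e by rewrite (le_lt_trans (dc _ nuK nut))// ltrDl.
  have := cvg_comp _ _ quot (@fan_piece_continuous R _ g nu d).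
  move=> /cvgr_lt /(_ _ dce); apply: filterS2 hpos => h h0 /=.
  by rewrite fan_pieceZ mulrC ltr_pdivrMr// mulrC (addrC h) => /ltW.
apply: filterS2 hcone hpiece => h [nu [nuK nut nuh]] /(_ _ nuK nut).
by rewrite fan_pieceB -(vg nu (phi t))// -(vg nu)// lerBlDl.
Qed.

(** * Dini comparison and switching *)

(** Once a line of slope e / (b - c) is subtracted, the minimum on [c, b] can only be at b: from an
    earlier point, growth at half that slope leads to a smaller value. Then e tends to 0, and c to a
    by continuity. *)
Lemma dini_nonincreasing (R : realType) (f : R -> R) (a b : R) : a < b ->
  {within `[a, b], continuous f} ->
  (forall t, a < t < b -> forall e, 0 < e ->
     \forall h \near (0 : R)^'+, f (t + h) <= f t + h * e) ->
  f b <= f a.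
Proof.
move=> ab fc fd.
have step c : a < c < b -> f b <= f c.
  move=> /andP[ac cb]; apply/ler_addgt0Pr => e e0.
  pose g t := f t - e / (b - c) * (t - c).
  have bc0 : 0 < b - c by rewrite subr_gt0.
  have ebc0 : 0 < e / (b - c) by rewrite divr_gt0.
  have gc : {within `[c, b], continuous g}.
    have fcb : {within `[c, b], continuous f}.
      by apply: continuous_subspaceW fc; apply: subset_itvr; rewrite bnd_simp ltW.
    have lc : {within `[c, b], continuous (fun t => e / (b - c) * (t - c))}.
      apply: continuous_subspaceT => y.
      by apply: cvgMl_tmp; apply: cvgB; [exact: cvg_id|exact: cvg_cst].
    by move=> x; apply: cvgB; [exact: fcb|exact: lc].
  have [m mcb mmin] := EVT_min (ltW cb) gc.
  have mb : m = b.
    apply/eqP; move: mcb; rewrite in_itv/= => /andP[cm]; rewrite le_eqVlt => /orP[//|mb].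
    have amb : a < m < b by rewrite (lt_le_trans ac cm) mb.
    have e2 : 0 < e / (b - c) / 2 by rewrite divr_gt0.
    have near_b : \forall h \near (0 : R)^'+, h < b - m.
      by apply: nbhs_right_lt; rewrite subr_gt0.
    near (0 : R)^'+ => h.
    have h0 : 0 < h by near: h; exact: nbhs_right_gt.
    have hb : h < b - m by near: h.
    have fh : f (m + h) <= f m + h * (e / (b - c) / 2) by near: h; exact: fd.
    have : g m <= g (m + h) by apply: mmin; rewrite in_itv/=; lra.
    rewrite /g; have := mulr_gt0 h0 ebc0; lra.
  have := mmin c; rewrite mb in_itv/= lexx (ltW cb) => /(_ isT).
  by rewrite /g subrr mulr0 subr0 divfK ?gt_eqF// lerBlDr.
have [_ fa _] := (continuous_within_itvP f ab).1 fc.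
apply: (cvgr_to_ge fa).
near=> c; apply: step; apply/andP; split; near: c.
- exact: nbhs_right_gt.
- exact: nbhs_right_lt.
Unshelve. all: by end_near.
Qed.

(** Reduction to [dini_nonincreasing] for exp (c t) v(t); the inequality 1 - c h <= exp (- c h)
    takes the place of a product rule. *)
Lemma dini_exp_decay (R : realType) (v : R -> R) (a b c : R) : a < b ->
  {within `[a, b], continuous v} -> (forall t, 0 <= v t) ->
  (forall t, a < t < b -> forall e, 0 < e ->
     \forall h \near (0 : R)^'+, v (t + h) <= v t + h * (- c * v t + e)) ->
  v b <= expR (- c * (b - a)) * v a.
Proof.
move=> ab vc v0 vd.
suff : expR (c * b) * v b <= expR (c * a) * v a.
  rewrite -ler_pdivlMl ?expR_gt0// -expRN mulrA -expRD.
  by congr (_ <= expR _ * _); ring.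
apply: (@dini_nonincreasing _ (fun t => expR (c * t) * v t)) => //.
  have ec : {within `[a, b], continuous (fun t => expR (c * t))}.
    apply: continuous_subspaceT => y; apply: continuous_comp.
      by apply: cvgMl_tmp; exact: cvg_id.
    exact: continuous_expR.
  by move=> x; apply: cvgM; [exact: ec|exact: vc].
move=> t atb e e0.
(* E bounds exp (c (t + h)) for 0 < h < 1, so an error e / E in the growth of v becomes at most e
   after multiplication. *)
pose E := expR (`|c| * (`|t| + 1)).
have E0 : 0 < E by exact: expR_gt0.
have eE : 0 < e / E by rewrite divr_gt0.
near=> h.
have h0 : 0 < h by near: h; exact: nbhs_right_gt.
have h1 : h < 1 by near: h; exact: nbhs_right_lt.
have vh : v (t + h) <= v t + h * (- c * v t + e / E) by near: h; exact: vd.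
apply: le_trans (ler_wpM2l (expR_ge0 _) vh) _.
have -> : v t + h * (- c * v t + e / E) = (1 + - (c * h)) * v t + h * (e / E).
  by ring.
rewrite mulrDr lerD//.
  rewrite mulrA ler_wpM2r// -[leRHS](_ : expR (c * (t + h)) * expR (- (c * h)) = _).
    by rewrite ler_wpM2l ?expR_ge0// expR_ge1Dx.
  by rewrite -expRD; congr expR; ring.
rewrite mulrCA ler_wpM2l ?(ltW h0)// mulrA ler_pdivrMr// mulrC ler_wpM2l ?(ltW e0)//.
rewrite ler_expR; apply: le_trans (ler_norm _) _; rewrite normrM ler_wpM2l//.
by rewrite (le_trans (ler_normD _ _))// lerD2l ger0_norm ltW.
Unshelve. all: by end_near.
Qed.

(** Connectedness of the interval: the indicator of one value of sigma is continuous there, and if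
    sigma took a second value the indicator would have to pass through 1 / 2. *)
Lemma no_switching_constant (R : realType) (P : {fset nat}) (sigma : R -> P)
    (s t : R) : 0 <= s -> s < t ->
  (forall r, s < r < t -> ~ switching_time sigma r) ->
  exists j, forall r, s < r < t -> sigma r = j.
Proof.
move=> s0 st nsw.
have loc r : s < r < t -> \forall u \near r, sigma u = sigma r.
  move=> srt; have /not_andP[|/contrapT//] := nsw _ srt.
  by have /andP[sr _] := srt; rewrite (le_lt_trans s0 sr).
have eq_lt r1 r2 : s < r1 -> r1 < r2 -> r2 < t -> sigma r1 = sigma r2.
  move=> sr1 r12 r2t; apply/eqP/negPn/negP => r12n.
  pose f r : R := (sigma r == sigma r1)%:R.
  have fc : {within `[r1, r2], continuous f}.
    apply: continuous_in_subspaceT => r; rewrite inE/= in_itv/= => /andP[r1r rr2].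
    have srt : s < r < t by rewrite (lt_le_trans sr1 r1r) (le_lt_trans rr2 r2t).
    apply: (near_cst_continuous (f r)).
    by apply: filterS (loc _ srt) => u ur; rewrite /f ur.
  have [|r _] := IVT (ltW r12) fc (v := 1 / 2).
    by rewrite /f eqxx eq_sym (negbTE r12n) /= min_r// max_l//; lra.
  by rewrite /f; case: eqP => _ /= /eqP; apply/negP; lra.
exists (sigma ((s + t) / 2)) => r /andP[sr rt].
by case: (ltgtP r ((s + t) / 2)) => [h|h|->//]; [|apply/esym]; apply: eq_lt; lra.
Qed.

(** The successor counts r itself, which both open windows leave out. *)
Lemma num_switches_split (R : realType) (P : {fset nat}) (sigma : R -> P)
    (s t r : R) : switching_signal sigma -> switching_time sigma r -> s < r < t ->
  num_switches sigma t s = (num_switches sigma r s + num_switches sigma t r).+1.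
Proof.
move=> [_ fin] swr /andP[sr rt].
have finS a b : finite_set [set u : R | switching_time sigma u /\ a < u < b].
  by apply: sub_finite_set (fin b) => u [swu /andP[_ /ltW ub]].
rewrite /num_switches.
have -> : [set u : R | switching_time sigma u /\ s < u < t] =
    r |` ([set u | switching_time sigma u /\ s < u < r] `|`
          [set u | switching_time sigma u /\ r < u < t]).
  apply/seteqP; split=> u.
    move=> [swu /andP[su ut]].
    by have [ur|ru|->] := ltgtP u r; [right; left|right; right|left];
      split=> //; apply/andP.
  move=> [->|[[swu /andP[su ur]]|[swu /andP[ru ut]]]]; first by rewrite /= sr rt.
    by split=> //; rewrite su (lt_trans ur rt).
  by split=> //; rewrite ut (lt_trans sr ru).
set A := [set u | _ /\ s < u < r]; set B := [set u | _ /\ r < u < t].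
have fA : finite_set A := finS s r; have fB : finite_set B := finS r t.
rewrite fset_setU1 ?finite_setU// cardfsU1 in_fset_set ?finite_setU//.
have -> /= : r \notin A `|` B.
  by rewrite notin_setE => -[[_]|[_]]; rewrite ltxx ?andbF.
rewrite fset_setU// cardfsU -fset_setI// (_ : A `&` B = set0).
  by rewrite fset_set0 cardfs0 subn0 add1n.
apply/seteqP; split=> u // [[_ /andP[_ ur]] [_ /andP[ru _]]].
by have := lt_trans ur ru; rewrite ltxx.
Qed.

(** Induction on the number of switches, cutting at any one of them. As k is arbitrary, the halves
    glue without matching modes. This costs one factor mu beyond the number of switches, and the
    exponents add up exactly because the cut is itself a switch. *)
Lemma switched_decay (R : realType) (P : {fset nat}) (sigma : R -> P)
    (W : P -> R -> R) (c mu : R) :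
  switching_signal sigma -> 1 <= mu -> (forall j t, 0 <= W j t) ->
  (forall j k t, W j t <= mu * W k t) ->
  (forall j s t, 0 <= s -> s < t ->
     (forall r, s < r < t -> ~ switching_time sigma r) ->
     (forall r, s < r < t -> sigma r = j) ->
     W j t <= expR (- c * (t - s)) * W j s) ->
  forall s t, 0 <= s -> s < t ->
  exists j, forall k, W j t <=
    mu ^+ (num_switches sigma t s).+1 * expR (- c * (t - s)) * W k s.
Proof.
move=> sw mu1 W0 Wmu Wdec s t.
have [N] := ubnP (num_switches sigma t s).
elim: N s t => // N IH s t; rewrite ltnS => leN s0 st.
have [none|some] := pselect (forall r, s < r < t -> ~ switching_time sigma r).
  have [j sj] := no_switching_constant s0 st none; exists j => k.
  apply: le_trans (Wdec j s t s0 st none sj) _.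
  rewrite [leRHS]mulrAC [leRHS]mulrC ler_wpM2l ?expR_ge0//.
  apply: le_trans (Wmu j k s) _; rewrite ler_wpM2r// exprS.
  by rewrite ler_peMr ?exprn_ege1// (le_trans _ mu1).
have [r srt swr] : exists2 r, s < r < t & switching_time sigma r.
  apply: contrapT => nex; apply: some => r srt swr; apply: nex; by exists r.
have /andP[sr rt] := srt.
have r0 : 0 <= r by rewrite (le_trans s0)// ltW.
have Nsplit := num_switches_split sw swr srt.
have [j1 hj1] : exists j, forall k, W j r <=
    mu ^+ (num_switches sigma r s).+1 * expR (- c * (r - s)) * W k s.
  by apply: IH => //; lia.
have [j2 hj2] : exists j, forall k, W j t <=
    mu ^+ (num_switches sigma t r).+1 * expR (- c * (t - r)) * W k r.
  by apply: IH => //; lia.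
exists j2 => k; apply: le_trans (hj2 j1) _.
have mu0 m : 0 <= mu ^+ m by rewrite exprn_ge0// (le_trans _ mu1).
apply: le_trans (ler_wpM2l _ (hj1 k)) _; first by rewrite mulr_ge0 ?expR_ge0.
rewrite mulrA mulrACA -exprD -expRD le_eqVlt; apply/orP; left; apply/eqP.
rewrite Nsplit; congr (_ ^+ _ * expR _ * _); first by lia.
by ring.
Qed.

(** * Consequences of the linear program *)

Lemma fan_pieceE (R : realType) (n : nat) (g : 'cV[R]_n -> R)
    (nu : simplex_index n) (x : 'cV[R]_n) :
  fan_piece g nu x =
  ((\row_l g (fan_vertex R nu l)) *m (invmx (Xmat R nu) *m x)) 0 0.
Proof.
by rewrite mxE; apply: eq_bigr => j _; rewrite mxE mulrC.
Qed.

Lemma fan_piece_sum (R : realType) (n : nat) (g : 'cV[R]_n -> R)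
    (nu : simplex_index n) (m : nat) (l : 'I_m -> R) (y : 'I_m -> 'cV[R]_n) :
  fan_piece g nu (\sum_j l j *: y j) = \sum_j l j * fan_piece g nu (y j).
Proof.
by rewrite linear_sum; apply: eq_bigr => j _; exact: fan_pieceZ.
Qed.

Lemma fan_interpolates_homogeneous (R : realType) (n K : nat)
    (g v : 'cV[R]_n.+1 -> R) (a : R) (x : 'cV[R]_n.+1) :
  (0 < K)%N -> fan_interpolates K g v -> 0 <= a -> v (a *: x) = a * v x.
Proof.
move=> K0 vg a0; have [nu nuK nux] := fan_cone_cover x K0.
rewrite (vg nu x)// (vg nu)// ?fan_pieceZ// => j.
by rewrite fan_coordZ mulr_ge0.
Qed.

Lemma fan_interpolates_linear (R : realType) (n K : nat)
    (g v : 'cV[R]_n.+1 -> R) (nu : simplex_index n.+1) :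
  fan_interpolates K g v -> TK R K nu ->
  exists f : {scalar 'cV[R]_n.+1}, forall x, fan_simplex nu x -> v x = f x.
Proof.
move=> vg nuK; exists (fan_piece g nu) => x [l [l0 _ xE]]; apply: (vg) => // j.
rewrite xE big_ord_recl unlift_none scaler0 add0r.
under eq_bigr do rewrite liftK.
by rewrite (fan_coord_sum (fun j => l (lift ord0 j)) _ nuK).
Qed.

Lemma fan_vertex_is_vertex (R : realType) (n K : nat)
    (nu : simplex_index n.+1) j : TK R K nu -> is_vertex K (fan_vertex R nu j).
Proof. by move=> nuK; exists nu => //; right; exists j. Qed.

(** The triangle inequality bounds the norm of x above by the weighted vertex norms, so the lower
    vertex bound passes to all x. For the upper bound it goes the wrong way, whence the constant
    taken as a maximum over the sphere. *)
Lemma LP_lower_bound (R : realType) (n K : nat) (P : {fset nat})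
    (A : P -> 'M[R]_n.+1) (amin amax mu alpha : R)
    (Vx : 'cV[R]_n.+1 -> P -> R) (i : P) (v : 'cV[R]_n.+1 -> R) x :
  (0 < K)%N -> 0 < amin -> LP_feasible A amin amax mu K alpha Vx ->
  fan_interpolates K (Vx^~ i) v -> amin * enorm x <= v x.
Proof.
move=> K0 amin0 lp vg; have [nu nuK nux] := fan_cone_cover x K0.
rewrite (vg nu x)// [X in enorm X](fan_coordK x nuK).
apply: le_trans (ler_wpM2l (ltW amin0) (enorm_sum_le _ nux)) _.
rewrite mulr_sumr ler_sum// => j _; rewrite mulrCA; apply: (ler_wpM2l (nux j)).
by have /andP[] := LP_bounds lp i (fan_vertex_is_vertex j nuK).
Qed.

Lemma LP_comparison (R : realType) (n K : nat) (P : {fset nat})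
    (A : P -> 'M[R]_n.+1) (amin amax mu alpha : R)
    (Vx : 'cV[R]_n.+1 -> P -> R) (i k : P) (v w : 'cV[R]_n.+1 -> R) x :
  (0 < K)%N -> LP_feasible A amin amax mu K alpha Vx ->
  fan_interpolates K (Vx^~ i) v -> fan_interpolates K (Vx^~ k) w ->
  v x <= mu * w x.
Proof.
move=> K0 lp vg wg; have [nu nuK nux] := fan_cone_cover x K0.
rewrite (vg nu x)// (wg nu x)// mulr_sumr ler_sum// => j _.
rewrite mulrCA; apply: (ler_wpM2l (nux j)).
exact: LP_mu lp _ _ _ (fan_vertex_is_vertex j nuK).
Qed.

(** At a vertex, the upper bound in (1) turns the right side of (2) into - alpha / amax times the
    vertex value. Both sides are linear in x, and the coordinates are nonnegative on the cone. *)
Lemma LP_piece_decrease (R : realType) (n K : nat) (P : {fset nat})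
    (A : P -> 'M[R]_n.+1) (amin amax mu alpha : R)
    (Vx : 'cV[R]_n.+1 -> P -> R) (i : P) (nu : simplex_index n.+1) x :
  0 < amax -> 0 <= alpha -> LP_feasible A amin amax mu K alpha Vx ->
  TK R K nu -> fan_cone nu x ->
  fan_piece (Vx^~ i) nu (A i *m x) <= - (alpha / amax) * fan_piece (Vx^~ i) nu x.
Proof.
move=> amax0 alpha0 lp nuK nux.
rewrite [in A i *m x](fan_coordK x nuK) mulmx_sumr.
under eq_bigr do rewrite -scalemxAr.
rewrite fan_piece_sum mulr_sumr ler_sum// => j _.
rewrite mulrCA; apply: (ler_wpM2l (nux j)).
rewrite fan_pieceE !mulmxA; apply: le_trans (LP_decrease lp nuK j i) _.
have /andP[_ up] := LP_bounds lp i (fan_vertex_is_vertex j nuK).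
rewrite !mulNr lerN2 mulrAC ler_pdivrMr// -mulrA ler_wpM2l//.
by rewrite mulrC.
Qed.

Lemma LP_growth (R : realType) (n K : nat) (P : {fset nat})
    (A : P -> 'M[R]_n.+1) (amin amax mu alpha : R)
    (Vx : 'cV[R]_n.+1 -> P -> R) (i : P) (v : 'cV[R]_n.+1 -> R)
    (phi : R -> 'cV[R]_n.+1) (t e : R) :
  (0 < K)%N -> 0 < amax -> 0 <= alpha -> LP_feasible A amin amax mu K alpha Vx ->
  fan_interpolates K (Vx^~ i) v -> is_derive t 1 phi (A i *m phi t) -> 0 < e ->
  \forall h \near (0 : R)^'+,
    v (phi (t + h)) <= v (phi t) + h * (- (alpha / amax) * v (phi t) + e).
Proof.
move=> K0 amax0 alpha0 lp vg phit e0.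
apply: (fan_interpolates_growth K0 vg phit) => // nu nuK nut.
by rewrite (vg _ _ nuK nut); exact: LP_piece_decrease lp nuK nut.
Qed.

Lemma LP_dini (R : realType) (n K : nat) (P : {fset nat})
    (A : P -> 'M[R]_n.+1) (amin amax mu alpha : R)
    (Vx : 'cV[R]_n.+1 -> P -> R) (i : P) (v : 'cV[R]_n.+1 -> R) x :
  (0 < K)%N -> 0 < amin -> 0 < amax -> 0 < alpha ->
  LP_feasible A amin amax mu K alpha Vx ->
  fan_interpolates K (Vx^~ i) v ->
  (dini v (A i) x <= (- (alpha / amax) * v x)%:E)%E.
Proof.
move=> K0 amin0 amax0 alpha0 lp vg; apply/lee_addgt0Pr => e e0.
rewrite /dini limf_esupE.
(* The upper limit is an infimum of suprema, so one set of the filter with quotients below the bound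
   plus e suffices. *)
pose B := [set h : R | (v (flow (A i) x h) - v x) / h <= - (alpha / amax) * v x + e].
suff near_B : \forall h \near (0 : R)^'+, B h.
  apply: le_trans (_ : ereal_sup [set ((v (flow (A i) x h) - v x) / h)%:E | h in B]
      <= _)%E.
    by apply: ereal_inf_lbound; exists B.
  by apply: ge_ereal_sup => _ [h Bh <-]; rewrite -EFinD lee_fin.
have pos := nbhs_right_gt (0 : R).
have [[phi0 phid]|flow0] :
    is_flow (A i) x (flow (A i) x) \/ flow (A i) x = fun=> 0.
  have [ex|nex] := pselect (exists phi, is_flow (A i) x phi).
    by left; exact: xgetPex ex.
  by right; apply: xgetPN => phi xphi; apply: nex; exists phi.
  have := LP_growth K0 amax0 (ltW alpha0) lp vg (phid 0) e0.
  apply: filterS2 pos => h h0; rewrite add0r phi0 => vh.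
  by rewrite /B/= ler_pdivrMr// lerBlDl [_ * h]mulrC.
(* Were there no solution, [flow] would be constantly 0 by default, and the
   difference quotient would tend to -oo. *)
have v0 : v 0 = 0.
  by rewrite -(scale0r x) (fan_interpolates_homogeneous _ K0 vg)// mul0r.
have vx0 : 0 <= v x.
  by apply: le_trans (LP_lower_bound x K0 amin0 lp vg); rewrite mulr_ge0 ?enorm_ge0// ltW.
(* For h < amax / alpha the quotient - v x / h is already at most - (alpha / amax) v x. *)
have small := nbhs_right_lt (divr_gt0 amax0 alpha0).
apply: filterS2 pos small => h h0 hs; rewrite /B/= flow0 v0 sub0r ler_pdivrMr//.
have : alpha / amax * h <= 1.
  by rewrite -[alpha / amax]invf_div mulrC ler_pdivrMr ?divr_gt0// mul1r ltW.
move=> /(ler_wpM2r vx0); rewrite mul1r => h1.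
by have := mulr_ge0 (ltW e0) (ltW h0); lra.
Qed.

(** * The maximum over the Euclidean unit sphere *)

Lemma trmx_row_continuous (R : realType) (n : nat) :
  continuous (fun w : 'rV[R]_n.+1 => w^T).
Proof.
move=> w; apply/(@cvgrPdist_lt _ _ _ _ (nbhs_filter w)) => e e0.
apply/nbhs_ballP; exists e => // y; rewrite -ball_normE /= => wy.
apply: le_lt_trans wy; rewrite -linearB /=.
have [k ->] := normr_coord_attained (w - y)^T; rewrite mxE.
rewrite [leRHS]/Num.Def.normr/= mx_normrE.
exact: (le_bigmax _ (fun ij : 'I_1 * 'I_n.+1 => `|(w - y) ij.1 ij.2|) (0, k)).
Qed.

Lemma enorm_continuous (R : realType) (n : nat) :
  continuous (@enorm R n).
Proof.
move=> x; apply: (@continuous_comp _ _ _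
  (fun x : 'cV[R]_n => \sum_(k < n) x k 0 ^+ 2) Num.sqrt);
  last exact: sqrt_continuous.
apply: continuous_big => [|k _ y]; first exact: add_continuous.
apply: (@continuous_comp _ _ _ (fun y : 'cV[R]_n => y k 0) (fun r => r ^+ 2)).
  exact: coord_continuous.
exact: exprn_continuous.
Qed.

(** Row vectors match [bounded_closed_compact]; transposition carries the maximum over to
    columns. *)
Lemma unit_sphere_compact (R : realType) (n : nat) :
  compact [set w : 'rV[R]_n.+1 | enorm w^T = 1].
Proof.
apply: bounded_closed_compact.
  exists 1; split=> // M M1 w /= w1; apply: le_trans (ltW M1).
  rewrite [leLHS]/Num.Def.normr/= mx_normrE.
  apply: bigmax_le => //= -[k j] _ /=; rewrite (ord1 k) -w1.
  by have := normr_coord_le_enorm w^T j; rewrite mxE.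
apply: (@closed_comp _ _ (fun w : 'rV[R]_n.+1 => enorm w^T) [set 1]).
  move=> w _; apply: continuous_comp; first exact: trmx_row_continuous.
  exact: enorm_continuous.
exact: closed_eq.
Qed.

Lemma family_max_on_sphere (R : realType) (n : nat) (P : finType)
    (V : P -> 'cV[R]_n.+1 -> R) (i0 : P) : (forall i, continuous (V i)) ->
  exists a, is_max [set y : R | exists x i, enorm x = 1 /\ y = V i x] a.
Proof.
move=> Vc.
have e1 : enorm (delta_mx 0 0 : 'rV[R]_n.+1)^T = 1.
  rewrite /enorm (bigD1 ord0)//= big1 => [|k /negbTE k0].
    by rewrite !mxE !eqxx expr1n addr0 sqrtr1.
  by rewrite !mxE k0 andbF expr0n.
have max1 i : exists x, enorm x = 1 /\ forall y, enorm y = 1 -> V i y <= V i x.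
  have [||w + wmax] := compact_EVT_max _ (@unit_sphere_compact R n)
     (f := fun w : 'rV[R]_n.+1 => V i w^T).
  - by exists (delta_mx 0 0).
  - apply: continuous_subspaceT => w; apply: continuous_comp; last exact: Vc.
    exact: trmx_row_continuous.
  rewrite inE /= => w1; exists w^T; split=> // y y1.
  by have := wmax y^T; rewrite inE/= trmxK; apply.
have [m mP] := choice max1.
have [i _ imax] := @arg_maxP _ _ _ i0 xpredT (fun i => V i (m i)) isT.
exists (V i (m i)); split; first by exists (m i), i; have [] := mP i.
move=> _ [x [j [x1 ->]]]; have [_ /(_ x x1) h] := mP j.
exact: le_trans h (imax j isT).
Qed.

Lemma fan_interpolates_upper (R : realType) (n K : nat) (a : R)
    (g v : 'cV[R]_n.+1 -> R) x :
  (0 < K)%N -> fan_interpolates K g v ->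
  (forall y, enorm y = 1 -> v y <= a) -> v x <= a * enorm x.
Proof.
move=> K0 vg va; have [->|x0] := eqVneq x 0.
  rewrite enorm0 mulr0 -[X in v X](scale0r 0).
  by rewrite (fan_interpolates_homogeneous _ K0 vg)// mul0r.
have e0 : 0 < enorm x by rewrite enorm_gt0.
have -> : x = enorm x *: ((enorm x)^-1 *: x).
  by rewrite scalerA divff ?gt_eqF// scale1r.
rewrite (fan_interpolates_homogeneous _ K0 vg) ?enorm_ge0// enormZ.
rewrite [enorm (_ *: x)]enormZ ger0_norm ?enorm_ge0// ger0_norm ?invr_ge0 ?enorm_ge0//.
rewrite mulVf ?gt_eqF// mulr1 mulrC ler_wpM2r ?enorm_ge0// va// enormZ.
by rewrite ger0_norm ?invr_ge0 ?enorm_ge0// mulVf// gt_eqF.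
Qed.

(** * Exponential stability under average dwell-time *)

(** The dwell-time bound turns the factor mu^(N+1) of [switched_decay] into a constant times exp (t
    ln mu / tau), which the decay at rate c outweighs; amin and amax' convert between V and the
    Euclidean norm. *)
Lemma LP_uniformly_GES (R : realType) (n K : nat) (P : {fset nat})
    (A : P -> 'M[R]_n.+1) (amin amax mu alpha amax' tau : R)
    (Vx : 'cV[R]_n.+1 -> P -> R) (V : P -> 'cV[R]_n.+1 -> R) :
  (0 < K)%N -> 0 < amin -> 0 < amax -> 1 <= mu -> 0 < alpha ->
  LP_feasible A amin amax mu K alpha Vx ->
  (forall i, fan_interpolates K (Vx^~ i) (V i)) ->
  0 <= amax' -> (forall i x, V i x <= amax' * enorm x) ->
  0 < tau -> tau > amax * ln mu / alpha -> uniformly_GES A tau.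
Proof.
move=> K0 amin0 amax0 mu1 alpha0 lp Vg amax'0 Vup tau0 tauP N0 N00.
set c := alpha / amax.
have mu0 : 0 < mu by exact: lt_le_trans ltr01 mu1.
have lnmu0 : 0 <= ln mu by exact: ln_ge0.
(* The condition on tau says exactly that this rate is positive. *)
have lam0 : 0 < c - ln mu / tau.
  rewrite subr_gt0 ltr_pdivrMr// /c mulrAC ltr_pdivlMr// mulrC.
  by rewrite [alpha * _]mulrC -ltr_pdivrMr.
(* The added 1 makes C at least 1, which settles t = 0; [switched_decay] requires s < t. *)
pose C := 1 + expR (ln mu * (N0 + 1)) * amax' / amin.
have C1 : 1 <= C by rewrite lerDl divr_ge0 ?(ltW amin0)// mulr_ge0 ?expR_ge0.
have C0 : 0 < C by exact: lt_le_trans C1.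
have Vlow i x : amin * enorm x <= V i x by exact: LP_lower_bound lp (Vg i).
have V0 i x : 0 <= V i x.
  by apply: le_trans (Vlow i x); rewrite mulr_ge0 ?enorm_ge0// ltW.
have Vc i : continuous (V i) by exact: fan_interpolates_continuous (Vg i).
exists C, (c - ln mu / tau); split=> // sigma sw dwell x [xc xd] t t0.
have [->|tn0] := eqVneq t 0.
  by rewrite mulr0 expR0 mulr1 ler_peMl// enorm_ge0.
have {tn0}t0 : 0 < t by rewrite lt_neqAle eq_sym tn0.
have [|||j hj] := @switched_decay R P sigma (fun i t => V i (x t))
  c mu sw mu1 _ _ _ 0 t (lexx 0) t0.
- by move=> *; exact: V0.
- by move=> i k s; exact: LP_comparison lp (Vg i) (Vg k).
- move=> i s r s0 sr nsw si.
  apply: (@dini_exp_decay _ (fun r => V i (x r))) => // [|u sur e e0].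
    have xsr : {within `[s, r], continuous x}.
      apply: continuous_subspaceW xc => u /=; rewrite in_itv/= => /andP[su _].
      exact: le_trans su.
    by move=> u; apply: continuous_comp; [exact: xsr|exact: Vc].
  apply: (LP_growth K0 amax0 (ltW alpha0) lp (Vg i)) => //.
  rewrite -(si _ sur); apply: xd; last exact: nsw.
  by have /andP[su _] := sur; exact: le_lt_trans su.
set N := num_switches sigma t 0 in hj.
have NN0 : N%:R <= N0 + t / tau by have := dwell t 0 (lexx 0) (ltW t0); rewrite subr0.
have muN : mu ^+ N.+1 <= expR (ln mu * (N0 + 1 + t / tau)).
  rewrite -[X in X ^+ _](lnK mu0) -expRM_natl ler_expR mulrC ler_wpM2l//.
  by rewrite -natr1; lra.
have V1 : V j (x t) <= expR (ln mu * (N0 + 1 + t / tau)) * expR (- c * t) *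
    (amax' * enorm (x 0)).
  apply: le_trans (hj j) _; rewrite subr0.
  apply: ler_pM => //; first by rewrite mulr_ge0 ?expR_ge0 ?exprn_ge0// ltW.
  by rewrite ler_wpM2r ?expR_ge0.
have {V1}V2 : enorm (x t) <= expR (ln mu * (N0 + 1)) * amax' / amin *
    expR (- (c - ln mu / tau) * t) * enorm (x 0).
  rewrite -(ler_pM2l amin0); apply: le_trans (Vlow j (x t)) _.
  apply: le_trans V1 _; rewrite -expRD le_eqVlt; apply/orP; left; apply/eqP.
  rewrite (_ : ln mu * (N0 + 1 + t / tau) + - c * t =
    ln mu * (N0 + 1) + - (c - ln mu / tau) * t); last by ring.
  by rewrite expRD; field; rewrite gt_eqF.
apply: le_trans V2 _; rewrite ler_wpM2r ?enorm_ge0// ler_wpM2r ?expR_ge0//.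
by rewrite /C lerDr.
Qed.

Unset Implicit Arguments.

Theorem mainTheorem1 (R : realType) (n : nat) (hn : (1 <= n)%N)
    (P : {fset nat}) (hP : P <> fset0) (A : P -> 'M[R]_n)
    (K : nat) (hK : (1 <= K)%N)
    (amin amax mu : R) (hamin : 0 < amin) (hamax : 0 < amax) (hmu : 1 <= mu)
    (alpha : R) (Vx : 'cV[R]_n -> P -> R)
    (hLP : LP_feasible A amin amax mu K alpha Vx) (halpha : 0 < alpha) :
  (forall (i : P) (x : 'cV[R]_n), exists! y : R, interpolant K Vx i x y) /\
  (forall V : P -> 'cV[R]_n -> R,
     (forall (i : P) (x : 'cV[R]_n), interpolant K Vx i x (V i x)) ->
     [/\ forall i : P, continuous (V i),
         forall (i : P) (nu : simplex_index n), TK R K nu ->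
           exists f : {scalar 'cV[R]_n},
             forall x : 'cV[R]_n, fan_simplex nu x -> V i x = f x
       & exists amax' : R,
           is_max [set y : R | exists (x : 'cV[R]_n) (i : P),
                     enorm x = 1 /\ y = V i x] amax' /\
           forall (x : 'cV[R]_n) (i k : P),
             [/\ amin * enorm x <= V i x <= amax' * enorm x,
                 (dini (V i) (A i) x <= (- (alpha / amax) * V i x)%:E)%E
               & V i x <= mu * V k x]]) /\
  (forall tau : R, 0 < tau -> tau > amax * ln mu / alpha ->
     uniformly_GES A tau).
Proof.
case: n hn A Vx hLP => [//|n] _ A Vx hLP.
have interp i x : exists! y, interpolant K Vx i x y.
  have [nu nuK nux] := fan_cone_cover x hK.
  exists (fan_piece (Vx^~ i) nu x); split=> [|y].
    by apply/(interpolantE Vx i _ nuK nux).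
  by move/(interpolantE Vx i _ nuK nux).
have interpV (V : P -> 'cV[R]_n.+1 -> R) :
    (forall i x, interpolant K Vx i x (V i x)) ->
    forall i, fan_interpolates K (Vx^~ i) (V i).
  by move=> VI i nu x nuK nux; apply/(interpolantE Vx i _ nuK nux).
have [i0] : exists i : P, True.
  have /fset0Pn[k kP] : P != fset0 by apply/eqP.
  by exists [` kP]%fset.
have bounds V : (forall i x, interpolant K Vx i x (V i x)) ->
    exists2 amax' : R, is_max [set y : R | exists (x : 'cV[R]_n.+1) (i : P),
      enorm x = 1 /\ y = V i x] amax' & forall i x, V i x <= amax' * enorm x.
  move=> /interpV Vg.
  have [a amaxV] := family_max_on_sphere i0
    (fun i => fan_interpolates_continuous hK (Vg i)).
  exists a => // i x; apply: (fan_interpolates_upper x hK (Vg i)) => y y1.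
  by apply: amaxV.2; exists y, i.
move=> _; split=> //; split=> [V VI|tau tau0 tauP].
  have Vg := interpV V VI; split.
  - by move=> i; exact: fan_interpolates_continuous (Vg i).
  - by move=> i nu; exact: fan_interpolates_linear (Vg i).
  have [a amaxV Va] := bounds V VI; exists a; split=> // x i k; split.
  - by rewrite Va andbT; exact: LP_lower_bound hLP (Vg i).
  - exact: LP_dini hLP (Vg i).
  - exact: LP_comparison hLP (Vg i) (Vg k).
(* The stability claim does not mention V, so interpolants are chosen here. *)
have /choice[V VI] : forall i, exists v, forall x, interpolant K Vx i x (v x).
  move=> i.
  have /choice[v vI] : forall x, exists y, interpolant K Vx i x y.
    by move=> x; have [y [yI _]] := interp i x; exists y.
  by exists v.
have [a [[x [i [x1 aE]]] _] Va] := bounds V VI.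
(* The maximum is attained at a unit vector, where V is at least amin. *)
have a0 : 0 <= a.
  rewrite aE; apply: le_trans (LP_lower_bound x hK hamin hLP (interpV V VI i)).
  by rewrite x1 mulr1 ltW.
exact: LP_uniformly_GES hLP (interpV V VI) a0 Va tau0 tauP.
Qed.
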